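(* Let $m\ge1$. Let $\widetilde W(u)$ be any formal power series in $u^{-1}$ with coefficients in the centre $\mathrm Z(\mathfrak f_m)$ of $\mathrm U(\mathfrak f_m)$ and with leading term $1$, such that $\widetilde W(-u)\,\widetilde W(u)^{-1}=1-\overline W(u)$, and let $\widetilde\beta_m:\mathrm X(\mathfrak g_n)\to\mathrm B_m$ be the homomorphism such that $\widetilde\beta_m(S_{ij}(u))=(\widetilde W(u)\otimes1)\,\beta_m(S_{ij}(u))$ for all $i,j=1,\dots,n$. Then the elements $O^{(1)},O^{(2)},\dots$ of $\mathrm X(\mathfrak g_n)$ belong to the kernel of $\widetilde\beta_m$.
   Context: Conventions. $n\ge1$ is an integer; $G_n$ is one of the complex groups $O_n$, $Sp_n$ ($n$ even if $G_n=Sp_n$). In all double signs $\pm,\mp$ the upper sign is for $G_n=O_n$, the lower sign for $G_n=Sp_n$. For $1\le i\le n$: $\tilde\imath=i-1$ if $i$ is even; $\tilde\imath=i+1$ if $i$ is odd and $i<n$; $\tilde\imath=n$ if $i=n$ is odd. $\theta_i=1$ if $G_n=O_n$, $\theta_i=(-1)^{i-1}$ if $G_n=Sp_n$. $G_n$ preserves the form $\langle e_i,e_j\rangle=\theta_i\delta_{\tilde\imath j}$ on $\mathbb C^n$; $\mathfrak g_n$ is its Lie algebra. $\mathrm X(\mathfrak g_n)$ (extended twisted Yangian) is the unital associative $\mathbb C$-algebra with generators $S_{ij}^{(r)}$ ($r\ge1$, $1\le i,j\le n$), $S_{ij}(u)=\delta_{ij}+\sum_{r\ge1}S_{ij}^{(r)}u^{-r}$,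 $S(u)=(S_{ij}(u))$, and relations $R(u-v)S_1(u)R'(-u-v)S_2(v)=S_2(v)R'(-u-v)S_1(u)R(u-v)$, where $R(u)=u-\sum_{i,j}E_{ij}\otimes E_{ji}$, $R'(u)=u-\sum_{i,j}\theta_i\theta_jE_{ij}\otimes E_{\tilde\imath\tilde\jmath}$, $S_1(u)=S(u)\otimes1$, $S_2(v)=1\otimes S(v)$. The central elements $O^{(r)}$ are the coefficients of the series $O(u)=1+O^{(1)}u^{-1}+O^{(2)}u^{-2}+\cdots$ in $\mathrm X(\mathfrak g_n)[[u^{-1}]]$ determined by $R'(0)\,S_1(u)\,R(2u)\,S_2(-u)^{-1}=(2u\mp1)\,O(u)\,R'(0)$. $\mathfrak f_m=\mathfrak{sp}_{2m}$ if $G_n=O_n$, $\mathfrak f_m=\mathfrak{so}_{2m}$ if $G_n=Sp_n$, realized inside $\mathfrak{gl}_{2m}$ (rows and columns labelled by $-m,\dots,-1,1,\dots,m$) as the span of $F_{ab}=E_{ab}-\varepsilon_{ab}E_{-b,-a}$, where $\varepsilon_{ab}=\operatorname{sign}a\cdot\operatorname{sign}b$ for $\mathfrak{sp}_{2m}$ and $\varepsilon_{ab}=1$ for $\mathfrak{so}_{2m}$. $F$ is the $2m\times2m$ matrix with entries $F_{ab}\in\mathrm U(\mathfrak f_m)$, $F_{ab}(u)$ is the $a,b$ entry of $(u-F)^{-1}$ (a power series in $u^{-1}$), and $W(u)=\sum_{|c|=1}^mF_{cc}(u)$; its coefficients lie in $\mathrm Z(\mathfrak f_m)$. The series $\overline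 W(u)$ in $u^{-1}$ is defined by $\big(1\mp\frac1{2u}\big)\overline W(u)=W(u\pm\frac12+m)$; it satisfies $(\overline W(u)-1)(\overline W(-u)-1)=1$, so series $\widetilde W(u)$ as in the claim exist. $\mathcal P(\mathbb C^m\otimes\mathbb C^n)$ is the polynomial ring in $x_{ai}$ ($1\le a\le m$, $1\le i\le n$), $\partial_{ai}$ are the partial derivations, $\mathcal{PD}(\mathbb C^m\otimes\mathbb C^n)$ is the ring of polynomial differential operators, $\mathrm B_m=\mathrm U(\mathfrak f_m)\otimes\mathcal{PD}(\mathbb C^m\otimes\mathbb C^n)$. For $c<0$ put $p_{ci}=x_{-c,i}$, $q_{ci}=\partial_{-c,i}$; for $c>0$ put $p_{ci}=-\theta_i\partial_{c\tilde\imath}$, $q_{ci}=\theta_ix_{c\tilde\imath}$. The homomorphism $\beta_m:\mathrm X(\mathfrak g_n)\to\mathrm B_m$ is $S_{ij}(u)\mapsto\delta_{ij}+\sum_{|c|,|d|=1}^mF_{cd}(u\pm\frac12+m)\otimes p_{ci}q_{dj}$. *)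

(* Defs.v *)
From HB Require Import structures.
From mathcomp Require Import all_boot all_order all_algebra generic_quotient.
From mathcomp Require Import boolp classical_sets fsbigop reals complex mxtens.
From mathcomp Require Import monalg mpoly.

Set Implicit Arguments.
Unset Strict Implicit.
Unset Printing Implicit Defensive.

Import Order.TTheory GRing.Theory Num.Theory.
Local Open Scope ring_scope.
Local Open Scope quotient_scope.

(** The library's [algType] requires [1 != 0], which is not available for an
    algebra given by generators and relations. Here a [K]-algebra is a possibly
    trivial ring with a morphism [kscal] from [K] to its centre. *)
HB.mixin Record isKAlg (K : pzRingType) A of GRing.PzRing A := {
  kscal : K -> A;
  kscalD : {morph kscal : c d / c + d};
  kscalM : {morph kscal : c d / c * d};
  kscal1 : kscal 1 = 1;
  kscalC : forall (c : K) (x : A), kscal c * x = x * kscal c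
}.

#[short(type="kalgType")]
HB.structure Definition KAlg (K : pzRingType) :=
  {A of GRing.PzRing A & isKAlg K A}.

Definition kalg_hom (K : pzRingType) (A B : kalgType K) (f : A -> B) : Prop :=
  forall c : K, f (kscal c) = kscal c.

(** Two-sided inverse, or [x] itself if there is none. *)
Definition cinv (A : pzRingType) (x : A) : A :=
  xget x [set y | y * x = 1 /\ x * y = 1].

Inductive ideal_span (A : pzRingType) (rel : set A) : A -> Prop :=
| IdealRel x : rel x -> ideal_span rel x
| Ideal0 : ideal_span rel 0
| IdealD x y : ideal_span rel x -> ideal_span rel y -> ideal_span rel (x + y)
| IdealM a x b : ideal_span rel x -> ideal_span rel (a * x * b).

Notation free_alg K I := {malg K[{fmonom I}]}.

Definition free_gen (K : comNzRingType) (I : choiceType) (i : I) :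
  free_alg K I := << fmu i >>.

Lemma free_scalC (K : comNzRingType) (I : choiceType) (c : K)
  (x : free_alg K I) : malgC c * x = x * malgC c.
Proof.
apply: etrans (fgmulUg _ _ _) _; apply: etrans _ (esym (fgmulgU _ _ _)).
by apply: eq_bigr => k _; rewrite mul1m mulm1 mulrC.
Qed.

Section Presented.
Variables (K : comNzRingType) (I : choiceType) (rel : set (free_alg K I)).
Local Notation F := (free_alg K I).
Local Notation J := (ideal_span rel).

Lemma ideal_spanN x : J x -> J (- x).
Proof. by move=> /(IdealM (-1) 1); rewrite mulN1r mulr1. Qed.

Lemma ideal_spanMl a x : J x -> J (a * x).
Proof. by move=> /(IdealM a 1); rewrite mulr1. Qed.

Lemma ideal_spanMr x b : J x -> J (x * b).
Proof. by move=> /(IdealM 1 b); rewrite mul1r. Qed.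

Definition pres_equiv (x y : F) : bool := `[< J (x - y) >].

Lemma pres_equiv_refl : reflexive pres_equiv.
Proof. by move=> x; apply/asboolP; rewrite subrr; exact: Ideal0. Qed.

Lemma pres_equiv_sym : ssrbool.symmetric pres_equiv.
Proof.
by move=> x y; apply/asboolP/asboolP => /ideal_spanN; rewrite opprB.
Qed.

Lemma pres_equiv_trans : transitive pres_equiv.
Proof.
move=> y x z /asboolP xy /asboolP yz; apply/asboolP.
by rewrite -(subrKA y); exact: IdealD.
Qed.

Canonical pres_equiv_rel :=
  EquivRel pres_equiv pres_equiv_refl pres_equiv_sym pres_equiv_trans.

(** The algebra with generators [I] and relations [x = 0] for [x] in [rel]:
    the quotient of the free algebra by the two-sided ideal spanned by [rel]. *)
Definition presented : Type := {eq_quot pres_equiv_rel}.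
HB.instance Definition _ := Choice.on presented.

Definition pres_pi (x : F) : presented := \pi_({eq_quot pres_equiv_rel}) x.

Definition pres_repr (x : presented) : F :=
  repr (x : {eq_quot pres_equiv_rel}).

Definition pres_gen (i : I) : presented := pres_pi (free_gen K i).

Lemma pres_reprK x : pres_pi (pres_repr x) = x.
Proof. exact: reprK. Qed.

Lemma pres_eqP x y : pres_pi x = pres_pi y <-> J (x - y).
Proof.
split=> [H|H]; last exact/eqquotP/asboolP.
by move: H => /eqquotP/asboolP.
Qed.

Lemma pres_repr_pi x : J (pres_repr (pres_pi x) - x).
Proof. by apply/pres_eqP; rewrite pres_reprK. Qed.

Definition pres_add (x y : presented) := pres_pi (pres_repr x + pres_repr y).
Definition pres_opp (x : presented) := pres_pi (- pres_repr x).
Definition pres_mul (x y : presented) := pres_pi (pres_repr x * pres_repr y).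

Lemma pres_addE x y : pres_add (pres_pi x) (pres_pi y) = pres_pi (x + y).
Proof.
by apply/pres_eqP; rewrite opprD addrACA; apply: IdealD; exact: pres_repr_pi.
Qed.

Lemma pres_oppE x : pres_opp (pres_pi x) = pres_pi (- x).
Proof.
by apply/pres_eqP; rewrite -opprD; apply: ideal_spanN; exact: pres_repr_pi.
Qed.

Lemma pres_mulE x y : pres_mul (pres_pi x) (pres_pi y) = pres_pi (x * y).
Proof.
apply/pres_eqP; have := pres_repr_pi x; have := pres_repr_pi y.
move: (pres_repr (pres_pi x)) (pres_repr (pres_pi y)) => a b /(ideal_spanMl x) Jb.
move=> /(ideal_spanMr b) Ja; have := IdealD Ja Jb.
by rewrite mulrBl mulrBr addrA subrK.
Qed.

Lemma pres_addA : associative pres_add.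
Proof.
move=> x y z; rewrite -[x]pres_reprK -[y]pres_reprK -[z]pres_reprK.
by rewrite !pres_addE addrA.
Qed.
Lemma pres_addC : commutative pres_add.
Proof. by move=> x y; rewrite /pres_add addrC. Qed.
Lemma pres_add0 : left_id (pres_pi 0) pres_add.
Proof. by move=> x; rewrite -[x]pres_reprK pres_addE add0r. Qed.
Lemma pres_addN : left_inverse (pres_pi 0) pres_opp pres_add.
Proof.
by move=> x; rewrite -[x]pres_reprK pres_oppE pres_addE addNr.
Qed.

HB.instance Definition _ :=
  GRing.isZmodule.Build presented pres_addA pres_addC pres_add0 pres_addN.

Lemma pres_piD : {morph pres_pi : x y / x + y}.
Proof. by move=> x y; rewrite -pres_addE. Qed.

Lemma pres_mulA : associative pres_mul.
Proof.
move=> x y z; rewrite -[x]pres_reprK -[y]pres_reprK -[z]pres_reprK.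
by rewrite !pres_mulE mulrA.
Qed.
Lemma pres_mul1 : left_id (pres_pi 1) pres_mul.
Proof. by move=> x; rewrite -[x]pres_reprK pres_mulE mul1r. Qed.
Lemma pres_mulr1 : right_id (pres_pi 1) pres_mul.
Proof. by move=> x; rewrite -[x]pres_reprK pres_mulE mulr1. Qed.
Lemma pres_mulDl : left_distributive pres_mul +%R.
Proof.
move=> x y z; rewrite -[x]pres_reprK -[y]pres_reprK -[z]pres_reprK.
by rewrite -pres_piD !pres_mulE -pres_piD mulrDl.
Qed.
Lemma pres_mulDr : right_distributive pres_mul +%R.
Proof.
move=> x y z; rewrite -[x]pres_reprK -[y]pres_reprK -[z]pres_reprK.
by rewrite -pres_piD !pres_mulE -pres_piD mulrDr.
Qed.

HB.instance Definition _ := GRing.Zmodule_isPzRing.Build presented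
  pres_mulA pres_mul1 pres_mulr1 pres_mulDl pres_mulDr.

Lemma pres_piM : {morph pres_pi : x y / x * y}.
Proof. by move=> x y; rewrite -pres_mulE. Qed.

Definition pres_scal (c : K) : presented := pres_pi (malgC c).

Lemma pres_scalD : {morph pres_scal : c d / c + d}.
Proof. by move=> c d; rewrite /pres_scal raddfD pres_piD. Qed.
Lemma pres_scalM : {morph pres_scal : c d / c * d}.
Proof. by move=> c d; rewrite /pres_scal rmorphM pres_piM. Qed.
Lemma pres_scal1 : pres_scal 1 = 1.
Proof. by rewrite /pres_scal rmorph1. Qed.
Lemma pres_scalC (c : K) (x : presented) : pres_scal c * x = x * pres_scal c.
Proof.
rewrite -[x]pres_reprK; move: (pres_repr x) => y.
apply: etrans (pres_piM _ _); apply: etrans (esym (pres_piM _ _)) _.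
exact: congr1 (free_scalC c y).
Qed.

HB.instance Definition _ := isKAlg.Build K presented
  pres_scalD pres_scalM pres_scal1 pres_scalC.

End Presented.

(** [A (x) B]: generated by the symbols [a (x) b], which are bilinear and
    multiply componentwise. *)
Section Tensor.
Variables (K : comNzRingType) (A B : kalgType K).
Local Notation F := (free_alg K (A * B)%type).
Local Notation "a '(x)' b" := (free_gen K (a, b)) (at level 40).

Inductive tens_rel : F -> Prop :=
| TensDl a a' b : tens_rel ((a + a') (x) b - (a (x) b + a' (x) b))
| TensDr a b b' : tens_rel (a (x) (b + b') - (a (x) b + a (x) b'))
| TensZl c a b : tens_rel ((kscal c * a) (x) b - malgC c * (a (x) b))
| TensZr c a b : tens_rel (a (x) (kscal c * b) - malgC c * (a (x) b))
| TensM a a' b b' :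
    tens_rel ((a * a') (x) (b * b') - (a (x) b) * (a' (x) b'))
| Tens1 : tens_rel (1 (x) 1 - 1).

Definition tensor : kalgType K := presented tens_rel.
Definition tens (a : A) (b : B) : tensor := pres_gen tens_rel (a, b).

Lemma tensDl b : {morph tens^~ b : a a' / a + a'}.
Proof.
move=> a a' /=; rewrite /tens /pres_gen -pres_piD; apply/pres_eqP.
exact/IdealRel/TensDl.
Qed.

End Tensor.

(** Formal Laurent series in [u^-1]: [f k] is the coefficient of [u ^ k]. *)
Section Laurent.
Variable A : pzRingType.

Definition bounded_above (f : int -> A) : Prop :=
  exists N : int, forall k, N < k -> f k = 0.

Record laurent := Laurent {
  lcoef :> int -> A;
  lcoef_bounded : bounded_above lcoef }.

Lemma laurentP (f g : laurent) : f =1 g -> f = g.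
Proof.
case: f g => [f Pf] [g Pg] /= /funext fg; rewrite fg in Pf *.
by congr Laurent; exact: Prop_irrelevance.
Qed.

HB.instance Definition _ := gen_eqMixin laurent.
HB.instance Definition _ := gen_choiceMixin laurent.

Lemma ladd_bounded (f g : laurent) : bounded_above (fun k => f k + g k).
Proof.
have [[M fM] [N gN]] := (lcoef_bounded f, lcoef_bounded g).
exists (Order.max M N) => k; rewrite gt_max => /andP[/fM-> /gN->].
by rewrite addr0.
Qed.
Lemma lopp_bounded (f : laurent) : bounded_above (fun k => - f k).
Proof.
by have [M fM] := lcoef_bounded f; exists M => k /fM ->; rewrite oppr0.
Qed.
Lemma lmono_bounded (j : int) (a : A) :
  bounded_above (fun k => if k == j then a else 0).
Proof. by exists j => k; rewrite lt_neqAle eq_sym => /andP[/negPf->]. Qed.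

(** [lmono j a] is [a u^j]. *)
Definition lmono (j : int) (a : A) := Laurent (lmono_bounded j a).
Definition ladd (f g : laurent) := Laurent (ladd_bounded f g).
Definition lopp (f : laurent) := Laurent (lopp_bounded f).

Lemma laddA : associative ladd.
Proof. by move=> f g h; apply: laurentP => k /=; rewrite addrA. Qed.
Lemma laddC : commutative ladd.
Proof. by move=> f g; apply: laurentP => k /=; rewrite addrC. Qed.
Lemma ladd0 : left_id (lmono 0 0) ladd.
Proof. by move=> f; apply: laurentP => k /=; rewrite if_same add0r. Qed.
Lemma laddN : left_inverse (lmono 0 0) lopp ladd.
Proof. by move=> f; apply: laurentP => k /=; rewrite if_same addNr. Qed.

HB.instance Definition _ :=
  GRing.isZmodule.Build laurent laddA laddC ladd0 laddN.

Definition lconv (f g : int -> A) (k : int) : A :=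
  \sum_(i \in [set: int]) f i * g (k - i).

Lemma fsumE (F : int -> A) (r : seq int) : uniq r ->
  (forall i, i \notin r -> F i = 0) ->
  \sum_(i \in [set: int]) F i = \sum_(i <- r) F i.
Proof.
move=> ur Fr; rewrite (fsbigE r)//; last by move=> i _; exact: Fr.
by apply: eq_bigl => i; rewrite in_setT.
Qed.

Definition irange (a b : int) : seq int :=
  [seq a + i%:Z | i <- iota 0 `|b - a|.+1].

Lemma irange_uniq a b : uniq (irange a b).
Proof. by rewrite map_inj_uniq ?iota_uniq// => i j /addrI []. Qed.

Lemma mem_irange a b i : a <= b -> (i \in irange a b) = (a <= i <= b).
Proof.
move=> ab; have ba0 : 0 <= b - a by rewrite subr_ge0.
apply/mapP/andP => [[t]|[ai ib]].
  rewrite mem_iota leq0n add0n ltnS -lez_nat gez0_abs// => tab ->.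
  by rewrite lerDl -lerBrDl.
have ia0 : 0 <= i - a by rewrite subr_ge0.
exists `|i - a|%N; last by rewrite gez0_abs// addrCA subrr addr0.
by rewrite mem_iota leq0n add0n ltnS -lez_nat !gez0_abs// lerB.
Qed.

Lemma irange_shift a b c : irange (a - c) (b - c) = [seq i - c | i <- irange a b].
Proof.
rewrite /irange -map_comp (_ : b - c - (a - c) = b - a); last first.
  by rewrite opprB addrA subrK.
by apply: eq_map => i /=; rewrite addrAC.
Qed.

Lemma notin_irange a b i : i \notin irange a b -> i < a \/ b < i.
Proof.
move=> H; have [ia|ai] := ltP i a; first by left.
have [bi|ib] := ltP b i; first by right.
by rewrite mem_irange ?ai ?ib ?(le_trans ai) in H.
Qed.

Lemma lconvE (f g : int -> A) M N k a b :
  (forall i, M < i -> f i = 0) -> (forall i, N < i -> g i = 0) ->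
  a <= k - N -> M <= b ->
  lconv f g k = \sum_(i <- irange a b) f i * g (k - i).
Proof.
move=> fM gN ak Mb; apply: fsumE; first exact: irange_uniq.
move=> i /notin_irange[ia|bi]; last by rewrite fM ?mul0r ?(le_lt_trans Mb).
by rewrite gN ?mulr0// ltrBrDl -ltrBrDr (lt_le_trans ia).
Qed.

Lemma lmul_bounded (f g : laurent) : bounded_above (lconv f g).
Proof.
have [[M fM] [N gN]] := (lcoef_bounded f, lcoef_bounded g).
exists (M + N) => k kMN; rewrite (lconvE fM gN (lexx _) (lexx _)).
rewrite big1 // => i _; have [/fM->|iM] := ltP M i; first by rewrite mul0r.
by rewrite gN ?mulr0// ltrBrDl (le_lt_trans _ kMN)// lerD2r.
Qed.

Definition lmul (f g : laurent) := Laurent (lmul_bounded f g).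

Lemma lmulA : associative lmul.
Proof.
move=> f g h; apply: laurentP => k /=.
have [L fL] := lcoef_bounded f; have [M gM] := lcoef_bounded g.
have [N hN] := lcoef_bounded h; have [P fgP] := lcoef_bounded (lmul f g).
have [Q ghQ] := lcoef_bounded (lmul g h).
pose c := k - N; pose a := Order.min (k - Q) (c - M).
pose b := Order.max L a; pose d := Order.max (Order.max P c) (M + b).
have ab : a <= b by rewrite le_max lexx orbT.
have cd : c <= d by rewrite !le_max lexx orbT.
rewrite (@lconvE f (lmul g h) L Q k a b) ?ge_min ?le_max ?lexx//.
rewrite (@lconvE (lmul f g) h P N k c d) ?le_max ?lexx//.
transitivity (\sum_(i <- irange a b) \sum_(l <- irange c d)
    f i * (g (l - i) * h (k - l))).
  rewrite !big_seq; apply: eq_bigr => i; rewrite mem_irange// => /andP[ai ib].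
  rewrite -mulr_sumr /= (@lconvE g h M N (k - i) (c - i) (d - i))//.
  - rewrite irange_shift big_map; congr (_ * _); apply: eq_bigr => l _.
    by rewrite opprB addrA subrK.
  - by rewrite /c addrAC.
  - by rewrite lerBrDr /d !le_max lerD2l ib orbT.
rewrite exchange_big /= !big_seq; apply: eq_bigr => l.
rewrite mem_irange// => /andP[cl ld].
rewrite (@lconvE f g L M l a b) ?le_max ?lexx//.
  by rewrite mulr_suml; apply: eq_bigr => i _; rewrite mulrA.
by rewrite ge_min lerD2r cl orbT.
Qed.

Lemma lmono_conv j x (F : int -> A) :
  \sum_(i \in [set: int]) (if i == j then x else 0) * F i = x * F j.
Proof.
rewrite (@fsumE _ [:: j])//; first by rewrite big_seq1 eqxx.
by move=> i; rewrite inE => /negPf->; rewrite mul0r.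
Qed.

Lemma lmul1 : left_id (lmono 0 1) lmul.
Proof.
move=> f; apply: laurentP => k /=.
by rewrite /lconv /= lmono_conv subr0 mul1r.
Qed.
Lemma lmulr1 : right_id (lmono 0 1) lmul.
Proof.
move=> f; apply: laurentP => k /=; rewrite /lconv /=.
rewrite (@fsumE _ [:: k])//; first by rewrite big_seq1 subrr eqxx mulr1.
by move=> i; rewrite inE subr_eq0 eq_sym => /negPf->; rewrite mulr0.
Qed.
Lemma lmulDl : left_distributive lmul +%R.
Proof.
move=> f g h; apply: laurentP => k /=.
have [M fM] := lcoef_bounded f; have [N gN] := lcoef_bounded g.
have [P hP] := lcoef_bounded h; have [Q fgQ] := lcoef_bounded (f + g).
pose b := Order.max (Order.max M N) Q; pose a := k - P.
rewrite (@lconvE (f + g) h Q P k a b) ?le_max ?lexx ?orbT//.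
rewrite (@lconvE f h M P k a b) ?le_max ?lexx ?orbT//.
rewrite (@lconvE g h N P k a b) ?le_max ?lexx ?orbT//.
by rewrite -big_split; apply: eq_bigr => i _; rewrite mulrDl.
Qed.
Lemma lmulDr : right_distributive lmul +%R.
Proof.
move=> h f g; apply: laurentP => k /=.
have [M fM] := lcoef_bounded f; have [N gN] := lcoef_bounded g.
have [P hP] := lcoef_bounded h; have [Q fgQ] := lcoef_bounded (f + g).
pose b := P; pose a := Order.min (Order.min (k - M) (k - N)) (k - Q).
rewrite (@lconvE h (f + g) P Q k a b) ?ge_min ?lexx ?orbT//.
rewrite (@lconvE h f P M k a b) ?ge_min ?lexx ?orbT//.
rewrite (@lconvE h g P N k a b) ?ge_min ?lexx ?orbT//.
by rewrite -big_split; apply: eq_bigr => i _; rewrite mulrDr.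
Qed.

HB.instance Definition _ := GRing.Zmodule_isPzRing.Build laurent
  lmulA lmul1 lmulr1 lmulDl lmulDr.

Lemma lseries_bounded (a : nat -> A) :
  bounded_above (fun k => if k <= 0 then a `|k|%N else 0).
Proof. by exists 0 => k; rewrite ltNge => /negPf->. Qed.
(** [\sum_(r >= 0) a r u^-r] *)
Definition lseries (a : nat -> A) := Laurent (lseries_bounded a).

Lemma lopp_var_bounded (f : laurent) :
  bounded_above (fun k => (-1) ^+ `|k|%N * f k).
Proof.
by have [M fM] := lcoef_bounded f; exists M => k /fM->; rewrite mulr0.
Qed.
(** [f(-u)] *)
Definition lopp_var (f : laurent) := Laurent (lopp_var_bounded f).

End Laurent.

(** [lconst a] is the constant series [a], and [lvar] the variable [u]. *)
Definition lconst (A : pzRingType) (a : A) : laurent A := lmono 0 a.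
Definition lvar (A : pzRingType) : laurent A := lmono 1 1.
Arguments lvar {A}.

Lemma lconst_is_additive (A : pzRingType) : zmod_morphism (@lconst A).
Proof.
move=> a b; apply: laurentP => k /=.
by case: eqP => // _; rewrite subr0.
Qed.
HB.instance Definition _ (A : pzRingType) :=
  GRing.isZmodMorphism.Build A (laurent A) (@lconst A) (@lconst_is_additive A).

Section LaurentMap.
Variables (A B : pzRingType) (phi : {additive A -> B}).
Lemma lmap_bounded (f : laurent A) : bounded_above (fun k => phi (f k)).
Proof.
by have [M fM] := lcoef_bounded f; exists M => k /fM->; rewrite raddf0.
Qed.
Definition lmap (f : laurent A) : laurent B := Laurent (lmap_bounded f).
End LaurentMap.

Section LaurentTranslate.
Variables (K : fieldType) (A : kalgType K).

(** The binomial coefficient [k (k - 1) ... (k - j + 1) / j!]. *)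
Definition int_bin (k : int) (j : nat) : K :=
  (\prod_(t < j) (k - t%:Z)%:~R) / (j`!)%:R.

Lemma ltranslate_bounded (c : K) (f : laurent A) : bounded_above (fun k =>
  \sum_(j \in [set: nat]) kscal (int_bin (k + j%:Z) j * c ^+ j) * f (k + j%:Z)).
Proof.
have [M fM] := lcoef_bounded f; exists M => k Mk.
by apply: fsbig1 => j _; rewrite fM ?mulr0// (lt_le_trans Mk)// lerDl.
Qed.
(** [f(u + c)]; [(u + c)^k] is expanded in powers of [u^-1] as
    [\sum_j int_bin k j c^j u^(k-j)]. *)
Definition ltranslate (c : K) (f : laurent A) :=
  Laurent (ltranslate_bounded c f).

End LaurentTranslate.

Section TensorSeries.
Variables (K : comNzRingType) (A B : kalgType K).

Definition tensr (b : B) (a : A) : tensor A B := tens a b.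

Lemma tensr_is_additive (b : B) : zmod_morphism (tensr b).
Proof. by move=> x y; apply: (addIr (tens y b)); rewrite -tensDl !subrK. Qed.
HB.instance Definition _ (b : B) := GRing.isZmodMorphism.Build
  A (tensor A B) (tensr b) (tensr_is_additive b).

(** [f(u) (x) b] *)
Definition ltens (f : laurent A) (b : B) : laurent (tensor A B) :=
  lmap (tensr b) f.

End TensorSeries.

Inductive classical_group := Orth | Symp.

(** The upper sign of a double sign is for [Orth], the lower for [Symp]. *)
Definition pm (A : pzRingType) (G : classical_group) (x : A) : A :=
  if G is Orth then x else - x.

(** The indices [1 .. n] are shifted to [0 .. n - 1], so that parities are
    exchanged; the last index is fixed when [n] is odd. *)
Definition tilde (n : nat) (i : 'I_n) : 'I_n :=
  insubd i (if odd i then i.-1 else i.+1).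

Definition theta (A : pzRingType) (G : classical_group) (n : nat) (i : 'I_n) :
  A := if G is Orth then 1 else (-1) ^+ i.

(** [End(C^n) (x) End(C^n)] is represented by Kronecker products. *)
Definition Rmx (A : pzRingType) (n : nat) (z : A) : 'M[A]_(n * n) :=
  z%:M - \sum_i \sum_j tensmx (delta_mx i j) (delta_mx j i).

Definition Rmx' (A : pzRingType) (G : classical_group) (n : nat) (z : A) :
  'M[A]_(n * n) :=
  z%:M - \sum_i \sum_j (theta A G i * theta A G j) *:
           tensmx (delta_mx i j) (delta_mx (tilde i) (tilde j)).

Definition mx1 (A : pzRingType) (n : nat) (M : 'M[A]_n) : 'M[A]_(n * n) :=
  tensmx M 1%:M.
Definition mx2 (A : pzRingType) (n : nat) (M : 'M[A]_n) : 'M[A]_(n * n) :=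
  tensmx 1%:M M.

(** [(r, i, j)] labels the generator [S_ij^(r + 1)]. *)
Definition Sindex (n : nat) : choiceType := (nat * 'I_n * 'I_n)%type.

Definition Sseries (A : pzRingType) (n : nat) (s : Sindex n -> A) :
  'M[laurent A]_n :=
  \matrix_(i, j) lseries (fun r => if r is r'.+1 then s (r', i, j)
                                   else (i == j)%:R).

Section Yangian.
Variables (K : fieldType) (G : classical_group) (n : nat).
Local Notation F := (free_alg K (Sindex n)).

Section ReflectionEquation.
Variables (A : pzRingType) (S : 'M[laurent A]_n).

(** In [laurent (laurent A)] the inner series variable is [u], the outer one
    is [v]. *)
Local Notation u := (lconst lvar : laurent (laurent A)).
Local Notation v := (lvar : laurent (laurent A)).
Local Notation Su := (map_mx (@lconst (laurent A)) S).
Local Notation Sv := (map_mx (lmap (@lconst A)) S).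

Definition reflection_lhs : 'M[laurent (laurent A)]_(n * n) :=
  Rmx n (u - v) *m mx1 Su *m Rmx' G n (- u - v) *m mx2 Sv.
Definition reflection_rhs : 'M[laurent (laurent A)]_(n * n) :=
  mx2 Sv *m Rmx' G n (- u - v) *m mx1 Su *m Rmx n (u - v).
End ReflectionEquation.

Definition Xrel : set F := [set x |
  let S := Sseries (free_gen K (I := Sindex n)) in
  exists p q k l, x = (reflection_lhs S p q) l k - (reflection_rhs S p q) l k].

Definition Xalg : kalgType K := presented Xrel.

Definition Smx : 'M[laurent Xalg]_n := Sseries (pres_gen Xrel).

Definition is_Oseries (O : nat -> Xalg) : Prop :=
  O 0 = 1 /\
  Rmx' G n 0 *m mx1 Smx *m Rmx n (lvar *+ 2)
      *m cinv (mx2 (map_mx (@lopp_var Xalg) Smx))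
    = ((lvar *+ 2 - pm G 1) * lseries O) *: Rmx' G n 0.

End Yangian.

Section Enveloping.
Variables (K : fieldType) (N : nat) (V : {vspace 'M[K]_N}).
Local Notation F := (free_alg K (subvs_of V)).
Local Notation g := (free_gen K (I := subvs_of V)).

(** Meant for [V] closed under commutators. *)
Inductive env_rel : F -> Prop :=
| EnvD x y : env_rel (g (x + y) - (g x + g y))
| EnvZ c x : env_rel (g (c *: x) - malgC c * g x)
| EnvLie x y z : vsval z = vsval x *m vsval y - vsval y *m vsval x ->
    env_rel (g x * g y - g y * g x - g z).

Definition envelop : kalgType K := presented env_rel.
Definition env_inj (x : subvs_of V) : envelop := pres_gen env_rel x.

End Enveloping.

Section Fm.
Variables (K : fieldType) (G : classical_group) (m : nat).

(** The labels [-m .. -1, 1 .. m]: [lshift m a] stands for [- (a + 1)] and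
    [rshift m a] for [a + 1]. *)
Definition lab_opp (c : 'I_(m + m)) : 'I_(m + m) :=
  match split c with inl a => rshift m a | inr a => lshift m a end.

Definition lab_sign (c : 'I_(m + m)) : K := if split c is inl _ then -1 else 1.

Definition feps (a b : 'I_(m + m)) : K :=
  if G is Orth then lab_sign a * lab_sign b else 1.

Definition Felt (a b : 'I_(m + m)) : 'M[K]_(m + m) :=
  delta_mx a b - feps a b *: delta_mx (lab_opp b) (lab_opp a).

Definition flie : {vspace 'M[K]_(m + m)} :=
  <<[seq Felt ab.1 ab.2 | ab : 'I_(m + m) * 'I_(m + m)]>>%VS.

Definition Uf : kalgType K := envelop flie.

Definition Fmx : 'M[Uf]_(m + m) :=
  \matrix_(a, b) env_inj (vsproj flie (Felt a b)).

Definition Fser : 'M[laurent Uf]_(m + m) :=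
  cinv (lvar%:M - map_mx (@lconst Uf) Fmx).

Definition Wser : laurent Uf := \sum_c Fser c c.

Definition fshift : K := pm G 2^-1 + m%:R.

(** The solution of [(1 -+ 1/(2u)) Wbar(u) = W(u +- 1/2 + m)]. *)
Definition Wbar : laurent Uf :=
  cinv (1 - pm G (lmono (-1) (kscal 2^-1))) * ltranslate fshift Wser.

Definition is_Wtilde (W : laurent Uf) : Prop :=
  [/\ forall k, 0 < k -> W k = 0,
      W 0 = 1,
      forall k x, W k * x = x * W k
    & lopp_var W * cinv W = 1 - Wbar].

End Fm.

Section PD.
Variables (K : fieldType) (m n : nat).
Local Notation P := {mpoly K[m * n]}.

Definition xvar (a : 'I_m) (i : 'I_n) : P := 'X_(mxtens_index (a, i)).
Definition xder (a : 'I_m) (i : 'I_n) : P -> P := mderiv (mxtens_index (a, i)).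

Inductive is_pdo : (P -> P) -> Prop :=
| PdoScal c : is_pdo (fun p => c *: p)
| PdoVar a i : is_pdo (fun p => xvar a i * p)
| PdoDer a i : is_pdo (xder a i)
| PdoAdd D E : is_pdo D -> is_pdo E -> is_pdo (fun p => D p + E p)
| PdoComp D E : is_pdo D -> is_pdo E -> is_pdo (fun p => D (E p)).

Record pdo := Pdo { pdo_fun :> P -> P; pdoP : is_pdo pdo_fun }.

Lemma pdo_eq (D E : pdo) : D =1 E -> D = E.
Proof.
case: D E => [D PD] [E PE] /= /funext DE; rewrite DE in PD *.
by congr Pdo; exact: Prop_irrelevance.
Qed.

Lemma pdoD (D : pdo) : {morph D : p q / p + q}.
Proof.
case: D => D PD /=; elim: D / PD => [c|a i|a i|D1 D2 _ I1 _ I2|D1 D2 _ I1 _ I2] p q.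
- exact: scalerDr.
- exact: mulrDr.
- exact: mderivD.
- by rewrite I1 I2 addrACA.
- by rewrite I2 I1.
Qed.

Lemma pdoZ (D : pdo) c p : D (c *: p) = c *: D p.
Proof.
case: D => D PD /=; elim: D / PD p => [d|a i|a i|D1 D2 _ I1 _ I2|D1 D2 _ I1 _ I2] p.
- by rewrite !scalerA mulrC.
- by rewrite scalerAr.
- exact: mderivZ.
- by rewrite I1 I2 scalerDr.
- by rewrite I2 I1.
Qed.

HB.instance Definition _ := gen_eqMixin pdo.
HB.instance Definition _ := gen_choiceMixin pdo.

Definition pdo_scal (c : K) := Pdo (PdoScal c).
Definition pdo_x (a : 'I_m) (i : 'I_n) := Pdo (PdoVar a i).
Definition pdo_d (a : 'I_m) (i : 'I_n) := Pdo (PdoDer a i).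
Definition pdo_add (D E : pdo) := Pdo (PdoAdd (pdoP D) (pdoP E)).
Definition pdo_mul (D E : pdo) := Pdo (PdoComp (pdoP D) (pdoP E)).
Definition pdo_opp (D : pdo) := pdo_mul (pdo_scal (-1)) D.

Lemma pdo_addA : associative pdo_add.
Proof. by move=> D E H; apply: pdo_eq => p /=; rewrite addrA. Qed.
Lemma pdo_addC : commutative pdo_add.
Proof. by move=> D E; apply: pdo_eq => p /=; rewrite addrC. Qed.
Lemma pdo_add0 : left_id (pdo_scal 0) pdo_add.
Proof. by move=> D; apply: pdo_eq => p /=; rewrite scale0r add0r. Qed.
Lemma pdo_addN : left_inverse (pdo_scal 0) pdo_opp pdo_add.
Proof.
by move=> D; apply: pdo_eq => p /=; rewrite scaleN1r addNr scale0r.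
Qed.

HB.instance Definition _ :=
  GRing.isZmodule.Build pdo pdo_addA pdo_addC pdo_add0 pdo_addN.

Lemma pdo_mulA : associative pdo_mul.
Proof. by move=> D E H; apply: pdo_eq. Qed.
Lemma pdo_mul1 : left_id (pdo_scal 1) pdo_mul.
Proof. by move=> D; apply: pdo_eq => p /=; rewrite scale1r. Qed.
Lemma pdo_mulr1 : right_id (pdo_scal 1) pdo_mul.
Proof. by move=> D; apply: pdo_eq => p /=; rewrite scale1r. Qed.
Lemma pdo_mulDl : left_distributive pdo_mul +%R.
Proof. by move=> D E H; apply: pdo_eq. Qed.
Lemma pdo_mulDr : right_distributive pdo_mul +%R.
Proof. by move=> D E H; apply: pdo_eq => p /=; rewrite pdoD. Qed.

HB.instance Definition _ := GRing.Zmodule_isPzRing.Build pdo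
  pdo_mulA pdo_mul1 pdo_mulr1 pdo_mulDl pdo_mulDr.

Lemma pdo_scalD : {morph pdo_scal : c d / c + d}.
Proof. by move=> c d; apply: pdo_eq => p /=; rewrite scalerDl. Qed.
Lemma pdo_scalM : {morph pdo_scal : c d / c * d}.
Proof. by move=> c d; apply: pdo_eq => p /=; rewrite scalerA. Qed.
Lemma pdo_scalC (c : K) (D : pdo) : pdo_scal c * D = D * pdo_scal c.
Proof. by apply: pdo_eq => p /=; rewrite pdoZ. Qed.

HB.instance Definition _ := isKAlg.Build K pdo
  pdo_scalD pdo_scalM erefl pdo_scalC.

End PD.

Section Beta.
Variables (K : fieldType) (G : classical_group) (n m : nat).

Definition pop (c : 'I_(m + m)) (i : 'I_n) : pdo K m n :=
  match split c with
  | inl a => pdo_x K a i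
  | inr a => - (theta _ G i * pdo_d K a (tilde i))
  end.

Definition qop (c : 'I_(m + m)) (i : 'I_n) : pdo K m n :=
  match split c with
  | inl a => pdo_d K a i
  | inr a => theta _ G i * pdo_x K a (tilde i)
  end.

Definition Balg : kalgType K := tensor (Uf K G m) (pdo K m n).

Definition beta_series (i j : 'I_n) : laurent Balg :=
  (i == j)%:R +
  \sum_c \sum_d
    ltens (ltranslate (fshift K G m) (Fser K G m c d)) (pop c i * qop d j).

End Beta.

(* Main.v *)
From HB Require Import structures.
Require Import Defs.
From mathcomp Require Import all_boot all_order all_algebra.
From mathcomp Require Import boolp classical_sets fsbigop reals complex mxtens.
From mathcomp Require Import monalg mpoly ring zify.

Set Implicit Arguments.
Unset Strict Implicit.
Unset Printing Implicit Defensive.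

Import Order.TTheory GRing.Theory Num.Theory.
Local Open Scope ring_scope.

(** The matrix [R'(0)] has rank one. Multiplied on the right by [S_2(-u)], the
    equation that defines [O(u)] therefore amounts to scalar relations in the
    extended twisted Yangian ([Oseries_relation]): writing [j~] for [tilde j],
    with the upper sign for [O_n] and the lower sign for [Sp_n],
    [[
      2u theta_i theta_j S_{j~ i~}(u) -+ S_ij(u) = (2u -+ 1) O(u) S_ij(-u).
    ]]
    The series [T_ij(u)], the images of the [S_ij(u)] under [beta], satisfy the
    same relations with the central factor [1 - Wbar(u)] in place of [O(u)]
    ([beta_relation]). By the choice of the renormalizing series,
    [W(u) (1 - Wbar(u)) = W(-u)]; hence multiplying the relation for [T] by
    the central series [W(u)] gives
    [[
      2u theta_i theta_j W(u) T_{j~ i~}(u) -+ W(u) T_ij(u)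
        = (2u -+ 1) W(-u) T_ij(-u),
    ]]
    whose left side is also [(2u -+ 1) betat(O(u)) W(-u) T_ij(-u)]. For [i = j]
    the series [W(-u) T_ii(-u)] is invertible, since its leading coefficient is
    [1], and so is [2u -+ 1]. Thus [betat(O(u)) = 1].

    The relation for [T] is a reflection property of the resolvent of [F]. Let
    [s = 2m +- 1], let [G(u)] be the inverse of [u + s/2 - F], and for a matrix
    [X] let [X^t] have the entries [eps_ab X_{-b,-a}], so that [F^t = - F]. If
    the entries of [F] commuted, transposing [G(u) (u + s/2 - F) = 1] would
    make [G^t(u)] an inverse of [u + s/2 + F]. In fact the entries of [G(u)]
    transform like those of [F] under the bracket with [F_ab]
    ([resolvent_bracket]), and reordering the factors leads to
    ([twist_resolvent])
    [[
      (s/2 - u - F) G^t(u) = tr G(u) - 1 +- G(u).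
    ]]
    Multiplying by [G(-u)], with [2u G(-u) G(u) = G(-u) - G(u)] and
    [2u tr G(u) = (2u -+ 1) Wbar(u)], one obtains ([Fhat_relation])
    [[
      2u G^t(u) +- G(u) = - (2u -+ 1) (1 - Wbar(u)) G(-u).
    ]]
    On the side of the differential operators,
    [theta_i theta_j p_{c j~} q_{d i~} = - eps_cd q_{-c,j} p_{-d,i}]
    ([pop_qop_tilde]), and [q] and [p] satisfy the canonical commutation
    relations ([qop_pop]). So passing from [T_ij(u)] to
    [theta_i theta_j T_{j~ i~}(u)] replaces [G(u)] by [- G^t(u)], up to a
    diagonal term [- tr G(u)] ([beta_series_tilde]), and the reflection property
    of [G] becomes the relation for [T]. *)

(** * Laurent series *)

Lemma cinvP (A : pzRingType) (x y : A) :
  y * x = 1 -> x * y = 1 -> cinv x * x = 1 /\ x * cinv x = 1.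
Proof.
by move=> yx xy; rewrite /cinv; case: xgetP => [z _ []//|/(_ y)[]].
Qed.

Section LaurentTheory.
Variable A : pzRingType.
Implicit Types f g : laurent A.

Definition degle (d : int) f := forall k, d < k -> f k = 0.

Lemma coefD f g k : (f + g) k = f k + g k. Proof. by []. Qed.
Lemma coefN f k : (- f) k = - f k. Proof. by []. Qed.
Lemma coefB f g k : (f - g) k = f k - g k. Proof. by []. Qed.
Lemma coef0 k : (0 : laurent A) k = 0. Proof. exact: if_same. Qed.
Lemma coef1 k : (1 : laurent A) k = (k == 0)%:R.
Proof. by rewrite /= [RHS]mulrb. Qed.
Lemma coef_lconst (a : A) k : lconst a k = if k == 0 then a else 0.
Proof. by []. Qed.

Lemma coef_sum (I : Type) (r : seq I) (P : pred I) (F : I -> laurent A) k :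
  (\sum_(i <- r | P i) F i) k = \sum_(i <- r | P i) F i k.
Proof. by elim/big_ind2: _ => [|f x g y <- <-|//]; rewrite ?coef0. Qed.

Lemma coefM f g M N k a b : degle M f -> degle N g -> a <= k - N -> M <= b ->
  (f * g) k = \sum_(i <- irange a b) f i * g (k - i).
Proof. exact: lconvE. Qed.

Lemma degle_bound f : exists d, degle d f.
Proof. exact: lcoef_bounded. Qed.

Lemma coef_lmonoM j (a : A) f k : (lmono j a * f) k = a * f (k - j).
Proof. exact: lmono_conv. Qed.

Lemma coef_Mlmono j (a : A) f k : (f * lmono j a) k = f (k - j) * a.
Proof.
rewrite /= /lconv /= (@fsumE _ _ [:: k - j])//.
  by rewrite big_seq1 subKr eqxx.
move=> i; rewrite inE => ikj; case: eqP => [kij|]; last by rewrite mulr0.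
by case/eqP: ikj; rewrite -kij subKr.
Qed.

Lemma lmono_mul i j (a b : A) : lmono i a * lmono j b = lmono (i + j) (a * b).
Proof.
apply: laurentP => k; rewrite coef_lmonoM /= subr_eq [j + i]addrC.
by case: eqP; rewrite ?mulr0.
Qed.

Lemma degleM d e f g : degle d f -> degle e g -> degle (d + e) (f * g).
Proof.
move=> fd ge k dek; rewrite (coefM fd ge (lexx _) (lexx _)).
rewrite big1 // => i _; have [/fd->|id] := ltP d i; first by rewrite mul0r.
by rewrite ge ?mulr0// ltrBrDl (le_lt_trans _ dek)// lerD2r.
Qed.

Lemma comm_laurent f g : (forall i j, f i * g j = g j * f i) -> f * g = g * f.
Proof.
move=> fg; have [M fM] := degle_bound f; have [N gN] := degle_bound g.
apply: laurentP => k; rewrite (coefM fM gN (lexx _) (lexx _)).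
set r := irange _ _; rewrite /= /lconv (@fsumE _ _ [seq k - i | i <- r]).
- by rewrite [RHS]big_map; apply: eq_bigr => i _; rewrite subKr fg.
- by rewrite map_inj_uniq ?irange_uniq// => x y /addrI/oppr_inj.
move=> j; have [jr|] := boolP (k - j \in r).
  by rewrite -{1}[j](subKr k) (map_f (fun i => k - i) jr).
move=> /notin_irange[ki|ki] _; last by rewrite [f _]fM ?mulr0.
by rewrite gN ?mul0r//; move: ki; rewrite ltrD2l ltrN2.
Qed.

Lemma lconst_mul (a b : A) : lconst (a * b) = lconst a * lconst b.
Proof. by rewrite /lconst lmono_mul add0r. Qed.

Lemma comm_lvar f : lvar * f = f * lvar.
Proof.
by apply: laurentP => k; rewrite coef_lmonoM coef_Mlmono mul1r mulr1.
Qed.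

Lemma coef_lvarM f k : (lvar * f) k = f (k - 1).
Proof. by rewrite coef_lmonoM mul1r. Qed.

(** The geometric series: [1 - h] is inverted by [sum_k h^k], whose
    coefficient at [u^-n] only involves the powers [k <= n]. *)
Lemma leading1_inverse f : degle 0 f -> f 0 = 1 ->
  exists g, g * f = 1 /\ f * g = 1.
Proof.
move=> f0 f1; pose h := 1 - f; have fE : f = 1 - h by rewrite /h subKr.
have hd : degle (- 1) h.
  move=> k k0; rewrite coefB coef1; case: (ltgtP k 0) => [|/f0->|->].
  - by move: k0; lia.
  - by rewrite subr0.
  - by rewrite f1 subrr.
have hX n : degle (- n%:Z) (h ^+ n).
  elim: n => [|n IH]; first by move=> k k0; rewrite coef1 gt_eqF.
  by rewrite exprS -add1n PoszD opprD; exact: degleM.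
pose s n := \sum_(i < n.+1) h ^+ i.
pose g : laurent A := lseries (fun n => s n (- n%:Z)).
(* [g] agrees with the [n]-th partial sum down to [u^-n], so the remainder has
   no effect on the coefficients of a product with [f] in that range. *)
have gs n : degle (- n.+1%:Z) (g - s n).
  move=> k nk; rewrite coefB /=; have [k0|k0] := ltP 0 k.
    rewrite coef_sum big1 ?subr0// => i _.
    by apply: hX; apply: le_lt_trans k0; rewrite oppr_le0.
  have -> : - `|k|%N%:Z = k by lia.
  rewrite !coef_sum; apply/eqP; rewrite subr_eq0; apply/eqP.
  have kn : (`|k|%N < n.+1)%N by lia.
  rewrite (big_ord_widen n.+1 (fun i => (h ^+ i) k)) //.
  rewrite [RHS](bigID (fun i : 'I_n.+1 => i < `|k|.+1)%N) /=.
  by rewrite [X in _ = _ + X]big1 ?addr0// => i ik; apply: hX; lia.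
have gd : degle 0 g by move=> k k0; rewrite /= leNgt k0.
have sl n : f * s n = 1 - h ^+ n.+1 by rewrite fE -opprB mulNr -subrX1 opprB.
have sr n : s n * f = 1 - h ^+ n.+1.
  rewrite -sl /s mulr_sumr mulr_suml; apply: eq_bigr => i _.
  by rewrite fE mulrBl mulrBr mul1r mulr1 -exprS -exprSr.
have key n k : - n%:Z <= k ->
    (f * g) k = (1 : laurent A) k /\ (g * f) k = (1 : laurent A) k.
  move=> nk; have nk' : - n.+1%:Z < k by lia.
  split.
    rewrite -[g](subrK (s n)) mulrDr sl coefD coefB (hX n.+1)// subr0.
    by rewrite (degleM f0 (gs n)) ?add0r.
  rewrite -[g](subrK (s n)) mulrDl sr coefD coefB (hX n.+1)// subr0.
  by rewrite (degleM (gs n) f0) ?add0r ?addr0.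
have key' k : - `|k|%N%:Z <= k by lia.
by exists g; split; apply: laurentP => k; case: (key `|k|%N k (key' k)).
Qed.

Lemma lvar_inverse : lvar * lmono (-1) 1 = 1 :> laurent A.
Proof. by rewrite lmono_mul mulr1. Qed.

Fact lopp_var_is_additive : zmod_morphism (@lopp_var A).
Proof. by move=> f g; apply: laurentP => k /=; rewrite mulrBr. Qed.

Fact lopp_var_is_multiplicative : monoid_morphism (@lopp_var A).
Proof.
split=> [|f g].
  apply: laurentP => k /=; case: eqP => [->|]; last by rewrite mulr0.
  by rewrite expr0 mulr1.
have [M fM] := degle_bound f; have [N gN] := degle_bound g.
have nM : degle M (lopp_var f) by move=> i /fM /= ->; rewrite mulr0.
have nN : degle N (lopp_var g) by move=> i /gN /= ->; rewrite mulr0.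
apply: laurentP => k; rewrite (coefM nM nN (lexx _) (lexx _)).
rewrite -[LHS]/((-1) ^+ `|k|%N * (f * g) k) (coefM fM gN (lexx _) (lexx _)).
rewrite mulr_sumr; apply: eq_bigr => i _ /=.
rewrite -[RHS]mulrA (mulrA (f i)) (commrX _ (commrN1 (f i))) -mulrA mulrA.
rewrite -exprD -signr_odd -[in RHS]signr_odd.
congr ((-1) ^+ (nat_of_bool _) * _).
lia.
Qed.

HB.instance Definition _ := GRing.isZmodMorphism.Build (laurent A) (laurent A)
  (@lopp_var A) lopp_var_is_additive.
HB.instance Definition _ := GRing.isMonoidMorphism.Build (laurent A) (laurent A)
  (@lopp_var A) lopp_var_is_multiplicative.

Lemma lopp_var_lvar : lopp_var (lvar : laurent A) = - lvar.
Proof.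
apply: laurentP => k; rewrite coefN /=; case: eqP => [->|_].
  by rewrite mulN1r.
by rewrite mulr0 oppr0.
Qed.

Lemma lopp_varK : involutive (@lopp_var A).
Proof. by move=> f; apply: laurentP => k; rewrite /= signrMK. Qed.
End LaurentTheory.

Section LaurentMapTheory.
Variables (A B : pzRingType) (phi : {rmorphism A -> B}).

Fact lmap_is_additive (psi : {additive A -> B}) : zmod_morphism (lmap psi).
Proof. by move=> f g; apply: laurentP => k /=; rewrite raddfB. Qed.
HB.instance Definition _ (psi : {additive A -> B}) :=
  GRing.isZmodMorphism.Build (laurent A) (laurent B) (lmap psi)
    (lmap_is_additive psi).

Fact lmap_is_multiplicative : monoid_morphism (lmap phi).
Proof.
split=> [|f g].
  by apply: laurentP => k /=; case: eqP => _; rewrite (rmorph1, rmorph0).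
have [M fM] := degle_bound f; have [N gN] := degle_bound g.
have pM : degle M (lmap phi f) by move=> i /fM /= ->; rewrite rmorph0.
have pN : degle N (lmap phi g) by move=> i /gN /= ->; rewrite rmorph0.
apply: laurentP => k; rewrite (coefM pM pN (lexx _) (lexx _)).
rewrite -[LHS]/(phi ((f * g) k)) (coefM fM gN (lexx _) (lexx _)) rmorph_sum.
by apply: eq_bigr => i _; rewrite rmorphM.
Qed.
HB.instance Definition _ :=
  GRing.isMonoidMorphism.Build (laurent A) (laurent B) (lmap phi)
    lmap_is_multiplicative.

Lemma lmap_lvar : lmap phi lvar = lvar.
Proof.
by apply: laurentP => k /=; case: eqP => _; rewrite (rmorph1, rmorph0).
Qed.

Lemma lmap_lopp_var f : lmap phi (lopp_var f) = lopp_var (lmap phi f).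
Proof. by apply: laurentP => k; rewrite /= rmorphMsign. Qed.

Lemma lmap_lseries (a : nat -> A) :
  lmap phi (lseries a) = lseries (phi \o a).
Proof. by apply: laurentP => k /=; case: ifP; rewrite // rmorph0. Qed.
End LaurentMapTheory.

Section LaurentMatrix.
Variables (A : pzRingType) (p : nat).

Definition mx_entry (i j : 'I_p) (M : 'M[A]_p) : A := M i j.
Fact mx_entry_is_additive i j : zmod_morphism (mx_entry i j).
Proof. by move=> M N; rewrite /mx_entry !mxE. Qed.
HB.instance Definition _ i j := GRing.isZmodMorphism.Build 'M[A]_p A
  (mx_entry i j) (mx_entry_is_additive i j).

Definition mx_of_laurent (f : laurent 'M[A]_p) : 'M[laurent A]_p :=
  \matrix_(i, j) lmap (mx_entry i j) f.

Lemma mx_of_laurent1 : mx_of_laurent 1 = 1%:M.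
Proof.
apply/matrixP => i j; rewrite !mxE; apply: laurentP => k /=.
rewrite /mx_entry; case: eqP => k0; last first.
  rewrite mxE; case: (i == j); rewrite ?mulr1n ?coef0 ?coef1 //.
  by case: eqP k0.
by rewrite mxE; case: (i == j); rewrite ?coef0 ?coef1 ?k0.
Qed.

Lemma mx_of_laurentM f g :
  mx_of_laurent (f * g) = mx_of_laurent f *m mx_of_laurent g.
Proof.
have [M fM] := degle_bound f; have [N gN] := degle_bound g.
apply/matrixP => i j; rewrite !mxE; apply: laurentP => k.
rewrite -[LHS]/(mx_entry i j ((f * g) k)) (coefM fM gN (lexx _) (lexx _)).
rewrite raddf_sum coef_sum.
under [RHS]eq_bigr => t _.
  have pM : degle M (mx_of_laurent f i t).
    by move=> l /fM; rewrite mxE /= => ->; rewrite raddf0.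
  have pN : degle N (mx_of_laurent g t j).
    by move=> l /gN; rewrite mxE /= => ->; rewrite raddf0.
  rewrite (coefM pM pN (lexx _) (lexx _)); over.
rewrite exchange_big; apply: eq_bigr => l _ /=.
by rewrite /mx_entry mxE; apply: eq_bigr => t _; rewrite !mxE.
Qed.

(** A square matrix of series with leading term the identity is a series of
    matrices with leading term [1], so the geometric series applies to it. *)
Lemma leading1_mx_inverse (X : 'M[laurent A]_p) :
  (forall i j, degle 0 (X i j)) -> (forall i j, X i j 0 = (i == j)%:R) ->
  exists Y, Y *m X = 1%:M /\ X *m Y = 1%:M.
Proof.
move=> Xd X0.
have fd : bounded_above (fun k => \matrix_(i, j) X i j k).
  by exists 0 => k k0; apply/matrixP => i j; rewrite !mxE Xd.
pose f := Laurent fd.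
have fX : mx_of_laurent f = X.
  apply/matrixP => i j; rewrite mxE; apply: laurentP => k.
  by rewrite /= /mx_entry mxE.
have [||g [gf fg]] := @leading1_inverse _ f.
- by move=> k k0; apply/matrixP => i j; rewrite !mxE Xd.
- by apply/matrixP => i j; rewrite !mxE X0.
by exists (mx_of_laurent g); rewrite -fX -!mx_of_laurentM gf fg mx_of_laurent1.
Qed.
End LaurentMatrix.

Section ConstantSeries.
Variable A : pzRingType.

Fact lconst_is_multiplicative : monoid_morphism (@lconst A).
Proof. by split; [| exact: lconst_mul]. Qed.
HB.instance Definition _ := GRing.isMonoidMorphism.Build A (laurent A)
  (@lconst A) lconst_is_multiplicative.
End ConstantSeries.

(** * Translation of the variable *)

Section Scalars.
Variables (K : pzRingType) (A : kalgType K).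

Fact kscal_is_additive : zmod_morphism (@kscal K A).
Proof. by move=> c d; apply: (addIr (kscal d)); rewrite -kscalD !subrK. Qed.
HB.instance Definition _ := GRing.isZmodMorphism.Build K A (@kscal K A)
  kscal_is_additive.

Fact kscal_is_multiplicative : monoid_morphism (@kscal K A).
Proof. by split; [exact: kscal1 | exact: kscalM]. Qed.
HB.instance Definition _ := GRing.isMonoidMorphism.Build K A (@kscal K A)
  kscal_is_multiplicative.
End Scalars.

Section Translation.
Variables (K : fieldType) (A : kalgType K) (c : K).
Hypothesis K_char0 : [pchar K] =i pred0.
Implicit Types f g : laurent A.

Lemma coef_ltranslate d n f k : degle d f -> d < k + n%:Z ->
  ltranslate c f k =
  \sum_(j < n) kscal (int_bin K (k + j%:Z) j * c ^+ j) * f (k + j%:Z).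
Proof.
move=> fd dkn; rewrite -(big_mkord xpredT
  (fun j => kscal (int_bin K (k + j%:Z) j * c ^+ j) * f (k + j%:Z))).
rewrite /= (fsbigE (index_iota 0 n)) ?iota_uniq //; last first.
  move=> j _; rewrite mem_index_iota /= -leqNgt => nj.
  by rewrite fd ?mulr0//; lia.
by apply: eq_bigl => j; rewrite in_setT.
Qed.

Fact ltranslate_is_additive : zmod_morphism (@ltranslate K A c).
Proof.
move=> f g; have [M fM] := degle_bound f; have [N gN] := degle_bound g.
apply: laurentP => k; pose n := (`|k| + `|M| + `|N|)%N.+1.
have kM : M < k + n%:Z by lia.
have kN : N < k + n%:Z by lia.
have fg : degle (k + n%:Z - 1) (f - g).
  by move=> l kl; rewrite coefB fM ?gN ?subrr//; lia.
have kfg : k + n%:Z - 1 < k + n%:Z by lia.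
rewrite (coef_ltranslate fg kfg) coefB.
rewrite (coef_ltranslate fM kM) (coef_ltranslate gN kN) -sumrB.
by apply: eq_bigr => j _; rewrite coefB mulrBr.
Qed.
HB.instance Definition _ := GRing.isZmodMorphism.Build (laurent A) (laurent A)
  (@ltranslate K A c) ltranslate_is_additive.

Lemma ltranslate_constM a f :
  ltranslate c (lconst a * f) = lconst a * ltranslate c f.
Proof.
have [M fM] := degle_bound f; apply: laurentP => k.
have afM : degle M (lconst a * f).
  by move=> l /fM fl; rewrite coef_lmonoM subr0 fl mulr0.
have kM : M < k + (`|k| + `|M|)%N.+1%:Z by lia.
rewrite coef_lmonoM subr0 (coef_ltranslate fM kM) (coef_ltranslate afM kM).
rewrite mulr_sumr; apply: eq_bigr => j _.
by rewrite coef_lmonoM subr0 mulrA kscalC !mulrA.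
Qed.

Lemma ltranslate_Mconst a f :
  ltranslate c (f * lconst a) = ltranslate c f * lconst a.
Proof.
have [M fM] := degle_bound f; apply: laurentP => k.
have afM : degle M (f * lconst a).
  by move=> l /fM fl; rewrite coef_Mlmono subr0 fl mul0r.
have kM : M < k + (`|k| + `|M|)%N.+1%:Z by lia.
rewrite coef_Mlmono subr0 (coef_ltranslate fM kM) (coef_ltranslate afM kM).
rewrite mulr_suml; apply: eq_bigr => j _.
by rewrite coef_Mlmono subr0 mulrA.
Qed.

Lemma int_bin0 x : int_bin K x 0 = 1.
Proof. by rewrite /int_bin big_ord0 fact0 divr1. Qed.

Lemma int_bin_pascal x j :
  int_bin K (x + 1) j.+1 = int_bin K x j.+1 + int_bin K x j.
Proof.
have K0 i : i`!%:R != 0 :> K.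
  by rewrite (pcharf0P _).1 // -lt0n fact_gt0.
rewrite /int_bin big_ord_recl [in X in _ = X + _]big_ord_recr /=.
set p := \prod_(i < j) (x - i%:Z)%:~R.
have -> : \prod_(i < j) (x + 1 - (lift ord0 i)%:Z)%:~R = p :> K.
  by apply: eq_bigr => i _; congr (_%:~R); rewrite /= /bump; lia.
have j0 : j.+1%:R != 0 :> K by rewrite (pcharf0P _).1.
by rewrite factS natrM; field; rewrite K0 addrC natr1 j0.
Qed.

(** Pascal's rule for the coefficients of [(u + c)^k]. Along with linearity over
    the constant series, this is the only compatibility of the translation with
    products that the resolvent [(u - F)^-1] calls for. *)
Lemma ltranslate_varM f :
  ltranslate c (lvar * f) = (lvar + lconst (kscal c)) * ltranslate c f.
Proof.
have [M fM] := degle_bound f; apply: laurentP => k.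
have ufM : degle (M + 1) (lvar * f).
  by move=> l Ml; rewrite coef_lvarM fM//; lia.
have [n kM] : exists n, M < k + n%:Z by exists (`|k| + `|M|)%N.+1; lia.
have kM1 : M + 1 < k + n.+1%:Z by lia.
have kM' : M < k - 1 + n.+1%:Z by lia.
rewrite mulrDl coefD coef_lvarM coef_lmonoM subr0.
rewrite (coef_ltranslate fM kM) (coef_ltranslate fM kM').
rewrite (coef_ltranslate ufM kM1).
under eq_bigr do rewrite coef_lvarM.
rewrite !big_ord_recl /= !addr0.
rewrite !int_bin0 -addrA; congr (_ + _).
rewrite mulr_sumr -big_split /=; apply: eq_bigr => j _.
have e : k + (bump 0 j)%:Z = (k + j%:Z) + 1 by rewrite /bump; lia.
have e' : k - 1 + (bump 0 j)%:Z = k + j%:Z by rewrite /bump; lia.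
rewrite e e' addrK mulrA -kscalM -mulrDl -kscalD /bump /= add1n.
by rewrite int_bin_pascal mulrDl exprS; congr (kscal _ * _); ring.
Qed.

Lemma ltranslate1 : ltranslate c (1 : laurent A) = 1.
Proof.
have d1 : degle 0 (1 : laurent A) by move=> k k0; rewrite coef1 gt_eqF.
apply: laurentP => k.
have k0 : 0 < k + `|k|%N.+1%:Z by lia.
rewrite (coef_ltranslate d1 k0) big_ord_recl /= addr0 int_bin0 mul1r kscal1.
rewrite mul1r big1 ?addr0// => j _; case: eqP => [->|]; last by rewrite mulr0.
by rewrite /int_bin big_ord_recl /= !mul0r rmorph0 mul0r.
Qed.
End Translation.

(** * Series with coefficients in a tensor product *)

Section TensorTheory.
Variables (K : comNzRingType) (A B : kalgType K).
Implicit Types (a : A) (b : B).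

Lemma tensDr a : {morph @tens K A B a : b b' / b + b'}.
Proof.
move=> b b'; rewrite /tens /pres_gen -pres_piD; apply/pres_eqP.
exact/IdealRel/TensDr.
Qed.

Lemma tens_mul a a' b b' : tens (a * a') (b * b') = tens a b * tens a' b'.
Proof.
rewrite /tens /pres_gen; apply: etrans (pres_piM _ _ _); apply/pres_eqP.
exact/IdealRel/TensM.
Qed.

Lemma tens1 : tens (1 : A) (1 : B) = 1.
Proof. by apply/pres_eqP; exact/IdealRel/Tens1. Qed.

Lemma ltensDr (f : laurent A) : {morph @ltens K A B f : b b' / b + b'}.
Proof. by move=> b b'; apply: laurentP => k; exact: tensDr. Qed.

Lemma ltens0r (f : laurent A) : ltens f (0 : B) = 0.
Proof. by apply: (addrI (ltens f 0)); rewrite -ltensDr !addr0. Qed.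

Lemma ltensNr (f : laurent A) b : ltens f (- b) = - ltens f b.
Proof. by apply/eqP; rewrite -addr_eq0 -ltensDr addNr ltens0r. Qed.

Lemma ltensDl b : {morph (@ltens K A B)^~ b : f g / f + g}.
Proof. exact: raddfD (lmap (tensr b)). Qed.

Lemma ltensNl b : {morph (@ltens K A B)^~ b : f / - f}.
Proof. exact: raddfN (lmap (tensr b)). Qed.

Lemma ltens_mul (f g : laurent A) b b' :
  ltens (f * g) (b * b') = ltens f b * ltens g b'.
Proof.
have [M fM] := degle_bound f; have [N gN] := degle_bound g.
have tM : degle M (ltens f b) by move=> i /fM /= ->; rewrite raddf0.
have tN : degle N (ltens g b') by move=> i /gN /= ->; rewrite raddf0.
apply: laurentP => k; rewrite (coefM tM tN (lexx _) (lexx _)).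
rewrite -[LHS]/(tensr (b * b') ((f * g) k)) (coefM fM gN (lexx _) (lexx _)).
by rewrite raddf_sum; apply: eq_bigr => i _; exact: tens_mul.
Qed.

Lemma ltens1 : ltens (1 : laurent A) (1 : B) = 1.
Proof.
apply: laurentP => k /=; case: eqP => _; last exact: raddf0.
exact: tens1.
Qed.

Lemma ltens_lvar : ltens (lvar : laurent A) (1 : B) = lvar.
Proof.
apply: laurentP => k /=; case: eqP => _; last exact: raddf0.
exact: tens1.
Qed.

Lemma ltens_lopp_var (f : laurent A) b :
  ltens (lopp_var f) b = lopp_var (ltens f b).
Proof.
apply: laurentP => k; rewrite /= -signr_odd -[in RHS]signr_odd.
by case: (odd _); rewrite ?expr0 ?expr1 ?mulN1r ?mul1r // raddfN.
Qed.
End TensorTheory.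

(** * Signs, labels and the twisted transpose *)

Section Labels.
Variables (L : pzRingType) (G : classical_group) (m : nat).
Local Notation lab := 'I_(m + m).
Local Notation opp := (@lab_opp m).

Lemma lab_oppK : involutive opp.
Proof.
move=> c; rewrite /lab_opp; case: (splitP c) => j cj.
  have -> : c = lshift m j by apply: val_inj.
  by rewrite !(unsplitK (inl j), unsplitK (inr j)).
have -> : c = rshift m j by apply: val_inj.
by rewrite !(unsplitK (inl j), unsplitK (inr j)).
Qed.

Lemma lab_opp_eq a b : (opp a == opp b) = (a == b).
Proof. exact: (inj_eq (inv_inj lab_oppK)). Qed.

Lemma lab_opp_eqC a b : (opp a == b) = (a == opp b).
Proof. by rewrite -lab_opp_eq lab_oppK. Qed.

Definition sgn (c : lab) : L := if split c is inl _ then -1 else 1.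

Lemma sgn_opp c : sgn (opp c) = - sgn c.
Proof.
rewrite /sgn /lab_opp; case: (split c) => j.
  by rewrite (unsplitK (inr j)) opprK.
by rewrite (unsplitK (inl j)).
Qed.

Lemma sgn_sqr c : sgn c * sgn c = 1.
Proof. by rewrite /sgn; case: split => _; rewrite ?mulrNN mulr1. Qed.

Lemma sgnC c x : sgn c * x = x * sgn c.
Proof.
by rewrite /sgn; case: split => _; rewrite ?mulN1r ?mulrN1 ?mul1r ?mulr1.
Qed.

Definition eps (a b : lab) : L := if G is Orth then sgn a * sgn b else 1.

Lemma epsC a b x : eps a b * x = x * eps a b.
Proof.
rewrite /eps; case: G; last by rewrite mul1r mulr1.
by rewrite -mulrA sgnC -mulrA sgnC mulrA.
Qed.

Lemma eps_trans a b c : eps a b * eps b c = eps a c.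
Proof.
rewrite /eps; case: G; last by rewrite mulr1.
by rewrite -mulrA (mulrA (sgn b)) sgn_sqr mul1r.
Qed.

Lemma eps_refl a : eps a a = 1.
Proof. by rewrite /eps sgn_sqr; case: G. Qed.

Lemma eps_sym a b : eps a b = eps b a.
Proof. by rewrite /eps sgnC. Qed.

Lemma eps_oppl a b : eps (opp a) b = - pm G (eps a b).
Proof. by rewrite /eps sgn_opp mulNr; case: G; rewrite ?opprK. Qed.

Lemma pmN (x : L) : pm G (- x) = - pm G x.
Proof. by case: G. Qed.

Lemma pmMl (x y : L) : pm G x * y = pm G (x * y).
Proof. by case: G; rewrite ?mulNr. Qed.

Lemma pmMr (x y : L) : x * pm G y = pm G (x * y).
Proof. by case: G; rewrite ?mulrN. Qed.

Lemma pmK : involutive (@pm L G).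
Proof. by case: G => x //=; rewrite opprK. Qed.

Lemma eps_opp a b : eps (opp a) (opp b) = eps a b.
Proof. by rewrite eps_oppl eps_sym eps_oppl eps_sym pmN pmK opprK. Qed.

(** Over a field of characteristic other than [2], the Lie algebra [f_m]
    consists of the matrices [X] with [twist X = - X]. *)
Definition twist (X : 'M[L]_(m + m)) : 'M[L]_(m + m) :=
  \matrix_(a, b) (eps a b * X (opp b) (opp a)).

(** The transpose of [E_ab - eps_ab E_{-b,-a}], read in any ring: the bracket
    with [F_ab] acts on the array of all the [F_cd] by the commutator with this
    matrix. *)
Definition coadj (a b : lab) : 'M[L]_(m + m) :=
  delta_mx b a - eps a b *: delta_mx (opp a) (opp b).

Lemma delta_mxM p q r (i : 'I_p) (j : 'I_q) (X : 'M[L]_(q, r)) c d :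
  (delta_mx i j *m X) c d = (c == i)%:R * X j d.
Proof.
rewrite mxE (bigD1 j) //= mxE eqxx andbT big1 ?addr0// => t /negPf tj.
by rewrite mxE tj andbF mul0r.
Qed.

Lemma mul_delta_mxE p q r (i : 'I_q) (j : 'I_r) (X : 'M[L]_(p, q)) c d :
  (X *m delta_mx i j) c d = X c i * (d == j)%:R.
Proof.
rewrite mxE (bigD1 i) //= mxE eqxx big1 ?addr0// => t /negPf ti.
by rewrite mxE ti mulr0.
Qed.

Lemma mul_mx_scalarE p q (X : 'M[L]_(p, q)) x c d :
  (X *m x%:M) c d = X c d * x.
Proof.
rewrite mxE (bigD1 d) //= mxE eqxx big1 ?addr0// => t /negPf td.
by rewrite mxE td mulr0.
Qed.

Lemma mul_scalar_mxE p q (X : 'M[L]_(p, q)) x c d :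
  (x%:M *m X) c d = x * X c d.
Proof. by rewrite mul_scalar_mx mxE. Qed.

Lemma mxBE p q (X Y : 'M[L]_(p, q)) i j : (X - Y) i j = X i j - Y i j.
Proof. by rewrite !mxE. Qed.

(** A rule for the brackets of [f] with all the entries of [X] becomes a
    commutation relation between matrices, which passes to the inverse of
    [X]. *)
Lemma comm_scalar_sub p (f : L) (X Z : 'M[L]_p) :
  X *m (f%:M - Z) = (f%:M - Z) *m X <->
  forall c d, f * X c d - X c d * f = (Z *m X - X *m Z) c d.
Proof.
have shuffle (a b c d : L) : a - b - (c - d) = - (b - d - (a - c)).
  by rewrite !opprB [LHS]addrACA [RHS]addrACA [- b - c]addrC.
split=> [/matrixP XZ c d|fX]; last first.
  apply/matrixP => c d; apply/eqP.
  rewrite mulmxBr mulmxBl !mxBE mul_mx_scalarE mul_scalar_mxE.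
  by rewrite -subr_eq0 -oppr_eq0 -shuffle subr_eq0 fX mxBE.
apply/eqP; rewrite mxBE -subr_eq0 shuffle oppr_eq0 subr_eq0.
have := XZ c d; rewrite mulmxBr mulmxBl !mxBE mul_mx_scalarE mul_scalar_mxE.
by move=> ->.
Qed.

Lemma coadjM a b p (X : 'M[L]_(_, p)) c d : (coadj a b *m X) c d =
  (c == b)%:R * X a d - eps a b * ((c == opp a)%:R * X (opp b) d).
Proof.
rewrite mulmxBl -scalemxAl [LHS]mxE delta_mxM; congr (_ + _).
by rewrite mxE mxE delta_mxM.
Qed.

Lemma mul_coadjE a b p (X : 'M[L]_(p, _)) c d : (X *m coadj a b) c d =
  X c b * (d == a)%:R - eps a b * (X c (opp a) * (d == opp b)%:R).
Proof.
rewrite mulmxBr [LHS]mxE mul_delta_mxE; congr (_ + _); rewrite mxE; congr (- _).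
rewrite -mul_delta_mxE !mxE mulr_sumr; apply: eq_bigr => t _.
by rewrite mxE mulrA -epsC -mulrA.
Qed.
Lemma coadj_bracketE a b (X : 'M[L]_(m + m)) c d :
  (coadj a b *m X - X *m coadj a b) c d =
  X a d *+ (b == c) - eps a b * (X (opp b) d *+ (opp a == c)) -
  (X c b *+ (d == a) - eps a b * (X c (opp a) *+ (d == opp b))).
Proof.
rewrite mxBE coadjM mul_coadjE !mulr_natl !mulr_natr.
by rewrite [c == b]eq_sym [c == opp a]eq_sym.
Qed.
End Labels.

(** * The resolvent of a twisted matrix *)

Section Resolvent.
Variables (L : pzRingType) (G : classical_group) (m : nat).
Local Notation lab := 'I_(m + m).
Local Notation opp := (@lab_opp m).
Local Notation eps := (@eps L G m).
Local Notation twist := (@twist L G m).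
Local Notation coadj := (@coadj L G m).
Variable F : 'M[L]_(m + m).
Hypothesis F_twist : twist F = - F.
Hypothesis F_bracket : forall a b c d,
  F a b * F c d - F c d * F a b = (coadj a b *m F - F *m coadj a b) c d.

Section Fixed.
Variables (x : L) (R : 'M[L]_(m + m)).
Hypothesis x_central : forall y, x * y = y * x.
Hypothesis RL : R *m (x%:M - F) = 1%:M.
Hypothesis RR : (x%:M - F) *m R = 1%:M.

(** The bracket hypothesis says that [F] commutes with the matrix
    [N = F_ab - coadj a b]; then so does the inverse of [x - F]. *)
Lemma resolvent_bracket a b c d :
  F a b * R c d - R c d * F a b = (coadj a b *m R - R *m coadj a b) c d.
Proof.
pose N := (F a b)%:M - coadj a b.
have xN : x%:M *m N = N *m x%:M.
  by apply/matrixP => i j; rewrite mul_mx_scalarE mul_scalar_mxE x_central.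
have FN : F *m N = N *m F by apply/comm_scalar_sub; exact: F_bracket.
have XN : (x%:M - F) *m N = N *m (x%:M - F) by rewrite mulmxBl xN FN -mulmxBr.
move: c d; apply/comm_scalar_sub; rewrite -/N -[LHS]mulmx1 -RR.
by rewrite mulmxA -(mulmxA R) -XN [R *m _]mulmxA RL mul1mx.
Qed.

(** The four Kronecker symbols in [coadj] contribute, in turn, [-+ R], the
    trace, [+- twist R] and, once the free index has been summed over, [2m]
    copies of [twist R]. *)
Lemma contracted_bracket a c :
  \sum_b (F a b * twist R b c - twist R b c * F a b) =
  twist R a c * ((m + m)%:R + pm G 1) - pm G (R a c) - (a == c)%:R * \tr R.
Proof.
have term b : F a b * twist R b c - twist R b c * F a b =
    (opp c == b)%:R * (eps b c * R a (opp b))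
    - (opp c == opp a)%:R * (R (opp b) (opp b))
    - ((opp b == a)%:R * (eps b c * R (opp c) b) - twist R a c).
  rewrite [twist R b c]mxE mulrA -epsC -!mulrA -mulrBr resolvent_bracket.
  rewrite mxBE coadjM mul_coadjE !mulrBr !mulrA [eps b c * eps a b]epsC.
  rewrite eps_trans eqxx mulr1 [twist R a c]mxE; congr (_ - _ - (_ - _)).
  - by case: eqP => _; rewrite ?mulr1 ?mul1r ?mulr0 ?mul0r.
  - rewrite lab_opp_eq [c == a]eq_sym; case: eqP => [->|_].
      by rewrite eps_refl mulr1.
    by rewrite mulr0.
  - by case: eqP => _; rewrite ?mulr1 ?mul1r ?mulr0 ?mul0r.
rewrite (eq_bigr _ (fun b _ => term b)) !sumrB.
have pick d (f : lab -> L) : \sum_b (d == b)%:R * f b = f d.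
  rewrite (bigD1 d) //= eqxx mul1r big1 ?addr0// => b /negPf bd.
  by rewrite eq_sym bd mul0r.
rewrite pick lab_oppK eps_oppl eps_refl mulNr pmMl mul1r.
rewrite -mulr_sumr lab_opp_eq [c == a]eq_sym.
have -> : \sum_b R (opp b) (opp b) = \tr R.
  by rewrite /mxtrace [RHS](reindex_inj (inv_inj (@lab_oppK m))).
under [X in _ - (X - _)]eq_bigr do rewrite lab_opp_eqC eq_sym.
rewrite pick sumr_const card_ord [twist R a c]mxE eps_oppl mulNr pmMl.
by rewrite mulrDr pmMr mulr1 mulr_natr opprB opprK [LHS]addrC addrA.
Qed.


(** The transpose of [R (x - F) = 1] has its factors in the wrong order; putting
    them right costs the contracted bracket, whence the shift of [x]. *)
Lemma twist_resolvent :
  (((m + m)%:R + pm G 1 - x)%:M - F) *m twist R =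
  (\tr R - 1)%:M + map_mx (pm G) R.
Proof.
set s := (m + m)%:R + pm G 1.
have s_central y : s * y = y * s.
  rewrite /s mulrDl mulrDr mulr_natl mulr_natr; congr (_ + _).
  by rewrite pmMl pmMr mul1r mulr1.
apply/matrixP => a c.
have tR : \sum_b twist R b c * F a b = (a == c)%:R - twist R a c * x.
  have := congr1 (fun X : 'M[L]_(m + m) => eps a c * X (opp c) (opp a)) RL.
  rewrite mulmxBr mxBE mul_mx_scalarE [1%:M _ _]mxE lab_opp_eq [c == a]eq_sym.
  have -> : eps a c * (a == c)%:R = (a == c)%:R.
    by case: eqP => [->|_]; rewrite ?mulr0 // eps_refl mul1r.
  move=> <-; rewrite mulrBr mulrA [twist R a c]mxE addrAC subrr add0r.
  rewrite mxE mulr_sumr -sumrN [RHS](reindex_inj (inv_inj (@lab_oppK m))) /=.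
  apply: eq_bigr => b _; rewrite [twist R b c]mxE.
  have /matrixP/(_ a)/(_ b) := F_twist; rewrite !mxE => FE.
  have -> : F a b = - (eps a b * F (opp b) (opp a)) by rewrite FE opprK.
  rewrite mulrN mulrA -(mulrA (eps b c)) -epsC mulrA [eps b c * _]epsC.
  by rewrite eps_trans !mulrA.
have := contracted_bracket a c; rewrite sumrB tR -/s => /eqP.
rewrite subr_eq => /eqP FtR.
rewrite mulmxBl mxBE mul_scalar_mxE [X in _ - X]mxE FtR !mxE.
have shuffle (p q r t d : L) : p - q - (p - r - t + (d - q)) = t - d + r.
  by rewrite opprD !opprB [t + (r - p)]addrA [LHS]addrACA subrKC addKr addrAC.
rewrite mulrBl s_central x_central shuffle; congr (_ + _).
by case: (a == c); rewrite ?mul1r ?mul0r ?subr0.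
Qed.

End Fixed.

Variables (u c : L) (Rp Rm : 'M[L]_(m + m)).
Hypothesis u_central : forall y, u * y = y * u.
Hypothesis c_central : forall y, c * y = y * c.
Hypothesis c_half : c *+ 2 = (m + m)%:R + pm G 1.
Hypothesis RpL : Rp *m ((u + c)%:M - F) = 1%:M.
Hypothesis RpR : ((u + c)%:M - F) *m Rp = 1%:M.
Hypothesis RmL : Rm *m ((- u + c)%:M - F) = 1%:M.

(** As [2c] is the shift [s] of [twist_resolvent], the points [x] and [s - x]
    are [c + u] and [c - u]; the resolvent identity [2u Rm Rp = Rm - Rp] then
    removes the product of two resolvents. *)
Lemma twist_resolvent_sym a b :
  u *+ 2 * twist Rp a b + pm G (Rp a b) =
  Rm a b * (u *+ 2 * (\tr Rp - 1) + pm G 1).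
Proof.
have uc_central y : (u + c) * y = y * (u + c).
  by rewrite mulrDl mulrDr u_central c_central.
have tw := twist_resolvent uc_central RpL RpR.
have e : (m + m)%:R + pm G 1 - (u + c) = - u + c.
  by rewrite -c_half mulr2n opprD addrACA subrr addr0 addrC.
have RmRp : u *+ 2 *: (Rm *m Rp) = Rm - Rp.
  have dX : (u *+ 2)%:M = (u + c)%:M - F - ((- u + c)%:M - F).
    rewrite opprB addrA subrK -raddfB opprD opprK addrACA subrr addr0.
    by rewrite mulr2n.
  transitivity (Rm *m (u *+ 2)%:M *m Rp).
    apply/matrixP => i j; rewrite -mulmxA mxE !mxE mulr_sumr.
    apply: eq_bigr => t _; rewrite mul_scalar_mxE !mulrA; congr (_ * _).
    by rewrite mulrnAl mulrnAr u_central.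
  by rewrite dX mulmxBr mulmxBl RmL mul1mx -mulmxA RpR mulmx1.
have := congr1 (mulmx Rm) tw; rewrite e mulmxA RmL mul1mx mulmxDr => ->.
have -> : Rm *m map_mx (pm G) Rp = map_mx (pm G) (Rm *m Rp).
  apply/matrixP => i j; rewrite !mxE /pm; case: G; last rewrite -sumrN.
    by apply: eq_bigr => t _; rewrite !mxE.
  by apply: eq_bigr => t _; rewrite !mxE mulrN.
have /matrixP/(_ a)/(_ b) := RmRp; rewrite mxBE mxE => RmRp_ab.
rewrite mxE mul_mx_scalarE mxE mulrDr mulrA.
have -> : u *+ 2 * Rm a b = Rm a b * u *+ 2 by rewrite mulrnAl u_central.
rewrite pmMr RmRp_ab [RHS]mulrDr [in RHS]pmMr mulr1 mulrA mulrnAr -addrA.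
congr (_ + _).
by rewrite /pm; case: G; rewrite -?opprD subrK.
Qed.
End Resolvent.

(** * The generators of the Lie algebra *)

Section Envelope.
Variables (K : fieldType) (N : nat) (V : {vspace 'M[K]_N}).
Implicit Types X Y : 'M[K]_N.

Definition env_of X : envelop V := env_inj (vsproj V X).

Lemma env_injD : {morph @env_inj K N V : x y / x + y}.
Proof.
move=> x y; apply: etrans (pres_piD _ _ _); apply/pres_eqP.
exact/IdealRel/EnvD.
Qed.

Fact env_of_is_additive : zmod_morphism env_of.
Proof.
move=> X Y; apply: (addIr (env_of Y)).
by rewrite subrK /env_of -env_injD -linearD subrK.
Qed.
HB.instance Definition _ := GRing.isZmodMorphism.Build 'M[K]_N (envelop V)
  env_of env_of_is_additive.

Lemma env_ofZ (c : K) X : env_of (c *: X) = kscal c * env_of X.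
Proof.
rewrite /env_of linearZ /=; apply: etrans (pres_piM _ _ _); apply/pres_eqP.
exact/IdealRel/EnvZ.
Qed.

Lemma env_inj_bracket (x y z : subvs_of V) :
  vsval z = vsval x *m vsval y - vsval y *m vsval x ->
  env_inj x * env_inj y = env_inj y * env_inj x + env_inj z.
Proof.
move=> zE; apply: etrans (esym (pres_piM _ _ _)) _.
apply: etrans _ (congr1 (+%R^~ _) (pres_piM _ _ _)).
apply: etrans _ (pres_piD _ _ _); apply/pres_eqP.
by rewrite opprD addrA; apply/IdealRel/EnvLie.
Qed.

Lemma env_of_bracket X Y : X \in V -> Y \in V -> X *m Y - Y *m X \in V ->
  env_of X * env_of Y - env_of Y * env_of X = env_of (X *m Y - Y *m X).
Proof.
move=> XV YV ZV; apply/eqP; rewrite subr_eq addrC; apply/eqP.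
by apply: env_inj_bracket; rewrite !vsprojK.
Qed.
End Envelope.

Section TwistMorphism.
Variables (A B : pzRingType) (phi : {rmorphism A -> B}).
Variables (G : classical_group) (m : nat).

Lemma rmorph_eps (a b : 'I_(m + m)) : phi (eps A G a b) = eps B G a b.
Proof.
have phi_sgn c : phi (@sgn A m c) = @sgn B m c.
  by rewrite /sgn; case: split => _; rewrite ?rmorphN1 ?rmorph1.
by rewrite /eps; case: G; rewrite ?rmorph1 // rmorphM !phi_sgn.
Qed.

Lemma rmorph_pm x : phi (pm G x) = pm G (phi x).
Proof. by rewrite /pm; case: G; rewrite ?rmorphN. Qed.

Lemma map_twist (X : 'M[A]_(m + m)) :
  map_mx phi (twist G X) = twist G (map_mx phi X).
Proof. by apply/matrixP => a b; rewrite !mxE rmorphM rmorph_eps. Qed.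

Lemma map_coadj (a b : 'I_(m + m)) :
  map_mx phi (coadj A G a b) = coadj B G a b.
Proof.
by apply/matrixP => c d; rewrite !mxE rmorphB rmorphM rmorph_eps !rmorph_nat.
Qed.
End TwistMorphism.

Section TwistedLie.
Variables (K : fieldType) (G : classical_group) (m : nat).
Local Notation lab := 'I_(m + m).
Local Notation opp := (@lab_opp m).
Local Notation U := (Uf K G m).
Local Notation Felt := (@Felt K G m).
Local Notation F := (Fmx K G m).
Local Notation tau := (@twist K G m).
Implicit Types (a b c d : lab) (X Y : 'M[K]_(m + m)).

Lemma twist_is_linear : linear tau.
Proof.
move=> k X Y; apply/matrixP => a b; rewrite !mxE mulrDr; congr (_ + _).
by rewrite mulrCA.
Qed.
HB.instance Definition _ := GRing.isLinear.Build K 'M[K]_(m + m) 'M[K]_(m + m)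
  *:%R tau twist_is_linear.

Lemma twistB X Y : tau (X - Y) = tau X - tau Y.
Proof. exact: linearB. Qed.

Lemma twistM X Y : tau (X *m Y) = tau Y *m tau X.
Proof.
apply/matrixP => a b; rewrite !mxE mulr_sumr.
rewrite (reindex_inj (inv_inj (@lab_oppK m))) /=; apply: eq_bigr => c _.
by rewrite !mxE -(eps_trans K G a c b) [X _ _ * Y _ _]mulrC mulrACA.
Qed.

Lemma twist_delta a b :
  tau (delta_mx a b) = feps K G a b *: delta_mx (opp b) (opp a).
Proof.
apply/matrixP => c d; rewrite !mxE -!(lab_opp_eqC _ a) -!(lab_opp_eqC _ b).
rewrite -[feps K G a b]/(eps K G a b).
have [<-|_] := eqVneq (opp d) a; last by rewrite andbF !mulr0.
have [<-|_] := eqVneq (opp c) b; last by rewrite !mulr0.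
by rewrite eps_opp eps_sym.
Qed.

Lemma twistK : involutive tau.
Proof.
move=> X; apply/matrixP => a b; rewrite !mxE !lab_oppK mulrA.
by rewrite eps_opp eps_trans eps_refl mul1r.
Qed.

Lemma FeltE a b : Felt a b = delta_mx a b - tau (delta_mx a b).
Proof. by rewrite twist_delta. Qed.

Lemma flie_antisym X : X - tau X \in flie K G m.
Proof.
rewrite [X in X - _]matrix_sum_delta [X in tau X]matrix_sum_delta.
rewrite linear_sum -sumrB rpred_sum // => a _.
rewrite linear_sum -sumrB rpred_sum // => b _.
rewrite linearZ -scalerBr rpredZ // -FeltE; apply: memv_span.
by apply/fintype.imageP; exists (a, b).
Qed.

(** Antisymmetrizing makes [gen] a linear map on all matrices, under which the
    matrix unit [E_ab] goes to [F_ab]; brackets can then be computed with matrix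
    units. *)
Definition gen X : U := env_of (flie K G m) (X - tau X).

Lemma genE a b : gen (delta_mx a b) = F a b.
Proof. by rewrite mxE /gen FeltE. Qed.

Lemma genB X Y : gen (X - Y) = gen X - gen Y.
Proof.
apply: etrans (raddfB (env_of (flie K G m)) _ _); congr (env_of _ _).
by rewrite twistB !opprB [LHS]addrACA [RHS]addrACA [- Y - _]addrC.
Qed.
HB.instance Definition _ := GRing.isZmodMorphism.Build 'M[K]_(m + m) U gen genB.

Lemma genMn X k : gen (X *+ k) = gen X *+ k.
Proof. exact: raddfMn. Qed.

Lemma genZ (k : K) X : gen (k *: X) = kscal k * gen X.
Proof. by rewrite /gen linearZ -scalerBr env_ofZ. Qed.

(** As [tau] is an antiautomorphism with [tau Z = - Z], the commutator of
    [Z] with [X - tau X] is [Y - tau Y] for [Y] that of [Z] with [X]. *)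
Lemma gen_bracket Z X : tau Z = - Z -> Z \in flie K G m ->
  env_of (flie K G m) Z * gen X - gen X * env_of (flie K G m) Z =
  gen (Z *m X - X *m Z).
Proof.
move=> tZ ZV; have e : Z *m (X - tau X) - (X - tau X) *m Z =
    (Z *m X - X *m Z) - tau (Z *m X - X *m Z).
  rewrite twistB !twistM tZ mulmxBl mulmxBr mulmxN mulNmx opprK.
  rewrite [- _ + _ in RHS]addrC !opprB [LHS]addrACA [RHS]addrACA.
  by rewrite [- (X *m Z) - _]addrC.
apply: etrans (env_of_bracket ZV (flie_antisym X) _) _; rewrite e //.
exact: flie_antisym.
Qed.

Lemma Fmx_bracket a b c d :
  F a b * F c d - F c d * F a b =
  (coadj U G a b *m F - F *m coadj U G a b) c d.
Proof.
have tF : tau (Felt a b) = - Felt a b.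
  by rewrite FeltE twistB twistK opprB.
have FV : Felt a b \in flie K G m by rewrite FeltE flie_antisym.
rewrite -[F c d]genE [F a b]mxE gen_bracket // /Felt.
rewrite mulmxBl mulmxBr -scalemxAl -scalemxAr !mul_delta_mx_cond.
apply: etrans _ (esym (coadj_bracketE _ _ _ _ _ _)).
rewrite !genB !genZ !genMn !genE.
by rewrite (rmorph_eps (@kscal K U)).
Qed.

Lemma gen_twist X : gen (tau X) = - gen X.
Proof.
apply: etrans (raddfN (env_of (flie K G m)) _); congr (env_of _ _).
by rewrite twistK opprB.
Qed.

Lemma Fmx_twist : twist G F = - F.
Proof.
apply/matrixP => a b; rewrite [LHS]mxE [RHS]mxE -(rmorph_eps (@kscal K U)).
rewrite -[F (opp b) (opp a)]genE -genZ -[eps K G a b]/(feps K G a b).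
by rewrite -twist_delta gen_twist genE.
Qed.
End TwistedLie.

(** * The resolvent as a Laurent series *)

Section ResolventSeries.
Variables (A : pzRingType) (p : nat) (F : 'M[A]_p).
Local Notation Fl := (map_mx (@lconst A) F).

(** [u - F] is [u] times [1 - u^-1 F], which has leading term [1]. *)
Lemma resolvent_inverse :
  exists Y : 'M[laurent A]_p,
    Y *m (lvar%:M - Fl) = 1%:M /\ (lvar%:M - Fl) *m Y = 1%:M.
Proof.
pose X : 'M[laurent A]_p := 1%:M - lmono (-1) 1 *: Fl.
have XE i j : X i j = (i == j)%:R - lmono (-1) (F i j).
  by rewrite !mxE /lconst lmono_mul addr0 mul1r.
have neg (a : A) k : 0 <= k -> lmono (-1) a k = 0.
  by move=> k0 /=; case: eqP => // k1; rewrite k1 in k0.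
have [||Y [YX XY]] := @leading1_mx_inverse _ _ X.
- move=> i j k k0; rewrite XE coefB neg // ?ltW // subr0.
  by case: (i == j); rewrite ?coef1 ?coef0 ?gt_eqF.
- move=> i j; rewrite XE coefB neg // subr0.
  by case: (i == j); rewrite ?coef1 ?coef0.
have lvarC (Z : 'M[laurent A]_p) : Z *m lvar%:M = lvar%:M *m Z.
  by apply/matrixP => i j; rewrite mul_mx_scalarE mul_scalar_mxE comm_lvar.
have V : (lmono (-1) 1)%:M *m lvar%:M = 1%:M :> 'M[laurent A]_p.
  by rewrite lvarC -scalar_mxM lvar_inverse.
have dE : lvar%:M - Fl = X *m lvar%:M.
  by rewrite lvarC mulmxBr mulmx1 -mul_scalar_mx mulmxA -lvarC V mul1mx.
exists ((lmono (-1) 1)%:M *m Y); rewrite dE; split.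
  by rewrite mulmxA -(mulmxA _ Y) YX mulmx1 V.
by rewrite mulmxA -(mulmxA X) -lvarC V mulmx1 XY.
Qed.

Definition resolvent : 'M[laurent A]_p := cinv (lvar%:M - Fl).

Lemma resolventK :
  resolvent *m (lvar%:M - Fl) = 1%:M /\ (lvar%:M - Fl) *m resolvent = 1%:M.
Proof. by have [Y [YX XY]] := resolvent_inverse; exact: cinvP YX XY. Qed.
End ResolventSeries.

Section ShiftedResolvent.
Variables (K : fieldType) (A : kalgType K) (G : classical_group) (m : nat).
Variables (c : K) (F : 'M[A]_(m + m)).
Hypothesis K_char0 : [pchar K] =i pred0.
Local Notation Fl := (map_mx (@lconst A) F).
Local Notation cs := (lconst (kscal c : A)).

Definition shifted_resolvent : 'M[laurent A]_(m + m) :=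
  map_mx (ltranslate c) (resolvent F).
Local Notation Rp := shifted_resolvent.

Lemma ltranslate_mx1 p :
  map_mx (@ltranslate K A c) 1%:M = 1%:M :> 'M[laurent A]_p.
Proof.
apply/matrixP => i j; rewrite !mxE; case: (i == j); first exact: ltranslate1.
exact: raddf0.
Qed.

Lemma lkscal_central k (f : laurent A) :
  lconst (kscal k) * f = f * lconst (kscal k).
Proof.
apply: comm_laurent => i j; rewrite coef_lconst.
by case: eqP; rewrite ?kscalC ?mul0r ?mulr0.
Qed.

Lemma shifted_var_central f : (lvar + cs) * f = f * (lvar + cs).
Proof. by rewrite mulrDl mulrDr comm_lvar lkscal_central. Qed.

Lemma shifted_resolventL : Rp *m ((lvar + cs)%:M - Fl) = 1%:M.
Proof.
have [RX _] := resolventK F; rewrite -ltranslate_mx1 -RX !mulmxBr map_mxB.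
congr (_ - _); apply/matrixP => i j.
  rewrite mul_mx_scalarE -shifted_var_central [RHS]mxE mul_mx_scalarE.
  by rewrite -comm_lvar [Rp i j]mxE; exact: esym (ltranslate_varM _ _ _).
rewrite mxE [RHS]mxE mxE raddf_sum; apply: eq_bigr => t _.
rewrite [Rp i t]mxE [Fl t j]mxE; exact: esym (ltranslate_Mconst _ _ _).
Qed.

Lemma shifted_resolventR : ((lvar + cs)%:M - Fl) *m Rp = 1%:M.
Proof.
have [_ XR] := resolventK F; rewrite -ltranslate_mx1 -XR !mulmxBl map_mxB.
congr (_ - _); apply/matrixP => i j.
  rewrite mul_scalar_mxE [RHS]mxE mul_scalar_mxE [Rp i j]mxE.
  exact: esym (ltranslate_varM _ _ _).
rewrite mxE [RHS]mxE mxE raddf_sum; apply: eq_bigr => t _.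
rewrite [Rp t j]mxE [Fl i t]mxE; exact: esym (ltranslate_constM _ _ _).
Qed.

Hypothesis F_twist : twist G F = - F.
Hypothesis F_bracket : forall a b c d,
  F a b * F c d - F c d * F a b = (coadj A G a b *m F - F *m coadj A G a b) c d.
Hypothesis c_half : c *+ 2 = (m + m)%:R + pm G 1.

Lemma shifted_resolvent_sym a b :
  lvar *+ 2 * twist G Rp a b + pm G (Rp a b) =
  lopp_var (Rp a b) * (lvar *+ 2 * (\tr Rp - 1) + pm G 1).
Proof.
have -> : lopp_var (Rp a b) = map_mx (@lopp_var A) Rp a b by rewrite [RHS]mxE.
apply: (@twist_resolvent_sym _ G m Fl _ _ lvar cs).
- by rewrite -map_twist F_twist map_mxN.
- move=> i j k l; rewrite -(map_coadj (@lconst A)) -!map_mxM -map_mxB.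
  rewrite [RHS]mxE -F_bracket [Fl i j]mxE [Fl k l]mxE -!lconst_mul.
  exact: esym (raddfB (@lconst A) _ _).
- exact: comm_lvar.
- exact: lkscal_central.
- rewrite -!raddfMn c_half !raddfD /= !rmorph_nat.
  by rewrite !(rmorph_pm, rmorph1).
- exact: shifted_resolventL.
- exact: shifted_resolventR.
have e : - lvar + cs = lopp_var (lvar + cs).
  rewrite raddfD /= lopp_var_lvar; congr (_ + _); apply: laurentP => k /=.
  by case: eqP => [->|]; rewrite ?mulr0 // expr0 mul1r.
have eF : Fl = map_mx (@lopp_var A) Fl.
  apply/matrixP => i j; rewrite !mxE; apply: laurentP => k /=.
  by case: eqP => [->|]; rewrite ?mulr0 // expr0 mul1r.
rewrite e eF -map_scalar_mx -map_mxB -map_mxM shifted_resolventL.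
exact: map_mx1.
Qed.
End ShiftedResolvent.

(** * The symmetry relation in the twisted Yangian *)

Section Tilde.
Variables (n : nat).

Lemma val_tilde (i : 'I_n) :
  tilde i = (if odd i then i.-1 else if i.+1 < n then i.+1 else i)%N :> nat.
Proof.
rewrite /tilde val_insubd; case: (odd i) => //=.
by rewrite (leq_ltn_trans (leq_pred _) (ltn_ord i)).
Qed.

Lemma tildeK : involutive (@tilde n).
Proof.
move=> i; apply: ord_inj; rewrite !val_tilde; have i_lt := ltn_ord i.
have [oi|ei] := boolP (odd i).
  have [-> ->] : odd i.-1 = false /\ i.-1.+1 = i by split; lia.
  by rewrite i_lt.
have [lt_i|] := boolP (i.+1 < n)%N; first by rewrite /= ei.
by rewrite (negPf ei) => /negPf ->.
Qed.

Lemma odd_tilde (i : 'I_n) : ~~ odd n -> odd (tilde i) = ~~ odd i.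
Proof. move=> n_even; rewrite val_tilde; have i_lt := ltn_ord i.
have [oi|ei] := boolP (odd i); first by lia.
by have [lt_i|] := boolP (i.+1 < n)%N; lia. Qed.

Variables (A : pzRingType) (G : classical_group).
Local Notation th := (@theta A G n).

Lemma theta_sqr i : th i * th i = 1.
Proof. by rewrite /theta; case: G; rewrite ?mulr1 // -expr2 sqrr_sign. Qed.

Lemma thetaC i (x : A) : th i * x = x * th i.
Proof.
rewrite /theta; case: G; first by rewrite mul1r mulr1.
by rewrite -signr_odd; case: (odd i); rewrite ?mulN1r ?mulrN1 ?mul1r ?mulr1.
Qed.

Lemma theta_tilde i : (G = Symp -> ~~ odd n) -> th (tilde i) = pm G (th i).
Proof.
rewrite /theta; case: G => // /(_ erefl) n_even /=.
rewrite -signr_odd odd_tilde // -[in RHS]signr_odd.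
by case: (odd i); rewrite ?opprK.
Qed.

Lemma theta_tilde2 i j : (G = Symp -> ~~ odd n) ->
  th (tilde i) * th (tilde j) = th i * th j.
Proof.
by move=> n_even; rewrite !theta_tilde // /pm; case: G; rewrite ?mulrNN.
Qed.

Lemma theta_tilde_self i : (G = Symp -> ~~ odd n) ->
  th (tilde i) * th i = pm G 1.
Proof. by move=> n_even; rewrite theta_tilde // pmMl theta_sqr. Qed.
End Tilde.

Section RankOne.
Variables (A : pzRingType) (G : classical_group) (n : nat).
Local Notation idx := mxtens_index.
Local Notation th := (@theta A G n).

Lemma sum_mxtens p q (f : 'I_(p * q) -> A) :
  \sum_k f k = \sum_i \sum_j f (idx (i, j)).
Proof.
rewrite pair_big_dep /= (reindex (@mxtens_index p q)) /=.
  by apply: eq_bigr => -[].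
exists (@mxtens_unindex p q) => k _; first exact: mxtens_indexK.
exact: mxtens_unindexK.
Qed.

Lemma sum_pick (I : finType) (i : I) (f : I -> A) :
  \sum_j f j *+ (j == i) = f i.
Proof.
by rewrite (bigD1 i) //= eqxx mulr1n big1 ?addr0// => j /negPf->.
Qed.

Lemma Rmx'0E a a' b b' : Rmx' G n 0 (idx (a, a')) (idx (b, b')) =
  - (th a * th b *+ (b' == tilde b) *+ (a' == tilde a)).
Proof.
rewrite /Rmx' raddf0 sub0r mxE; congr (- _); rewrite summxE.
under eq_bigr => i _.
  rewrite summxE.
  under eq_bigr => j _.
    rewrite mxE tensmxE !mxE -natrM mulnb mulr_natr.
    have -> : ((a == i) && (b == j) && ((a' == tilde i) && (b' == tilde j)))
      = (j == b) && ((i == a) && (a' == tilde i) && (b' == tilde j)).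
      by rewrite [a == i]eq_sym [b == j]eq_sym; do !case: (_ == _).
    rewrite -mulnb mulnC mulrnA; over.
  rewrite sum_pick -andbA -mulnb mulnC mulrnA; over.
by rewrite sum_pick -mulnb mulnC mulrnA.
Qed.

Lemma RmxE (z : A) a a' b b' : Rmx n z (idx (a, a')) (idx (b, b')) =
  z *+ ((a == b) && (a' == b')) - ((a == b') && (a' == b))%:R.
Proof.
rewrite /Rmx mxE mxE (inj_eq (can_inj (@mxtens_indexK n n))); congr (_ + _).
rewrite mxE summxE; congr (- _).
under eq_bigr => i _.
  rewrite summxE.
  under eq_bigr => j _.
    rewrite tensmxE !mxE -natrM mulnb.
    have -> : ((a == i) && (b == j) && ((a' == j) && (b' == i)))
      = (j == b) && ((i == a) && (b' == i) && (a' == j)).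
      by rewrite [a == i]eq_sym [b == j]eq_sym; do !case: (_ == _).
    rewrite -mulnb mulnC mulrnA; over.
  rewrite sum_pick -andbA -mulnb mulnC mulrnA; over.
by rewrite sum_pick [b' == a]eq_sym.
Qed.

(** The nonzero rows of the rank one matrix [R'(0)] are those labelled
    [(k, tilde k)], and they are proportional: the [n * n] entries of one such
    row carry the whole matrix equation. *)
Lemma rank_one_relation (z o : A) (S T : 'M[A]_n) :
  (forall x, z * x = x * z) -> (G = Symp -> ~~ odd n) ->
  Rmx' G n 0 *m mx1 S *m Rmx n z = o *: (Rmx' G n 0 *m mx2 T) ->
  forall i j,
  z * (th i * th j * S (tilde j) (tilde i)) - pm G (S i j) = o * T i j.
Proof.
move=> zC n_even RS i j.
(* In the row [(k, tilde k)] and the column [(k, j)], the right side is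
   [- o * T i j], because [tilde k = i]. *)
pose k := tilde i.
have R'M (X : 'M[A]_(n * n)) l : (Rmx' G n 0 *m X) (idx (k, tilde k)) l =
    - \sum_b th k * th b * X (idx (b, tilde b)) l.
  rewrite mxE sum_mxtens -sumrN; apply: eq_bigr => b _.
  under eq_bigr do rewrite Rmx'0E eqxx mulr1n mulNr mulrnAl -mulNrn.
  by rewrite sum_pick.
have SRE b l l' : (mx1 S *m Rmx n z) (idx (b, tilde b)) (idx (l, l')) =
    S b l * z *+ (tilde b == l') - S b l' *+ (tilde b == l).
  rewrite mxE sum_mxtens.
  under eq_bigr => d _.
    under eq_bigr do rewrite tensmxE mxE mulr_natr mulrnAl eq_sym RmxE.
    rewrite sum_pick mulrBr mulrnAr mulr_natr -mulnb mulnC mulrnA.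
    rewrite -[in X in _ - X]mulnb [in X in _ - X]mulnC [in X in _ - X]mulrnA.
    over.
  by rewrite sumrB !sum_pick.
have TE b l : (mx2 T) (idx (b, tilde b)) (idx (l, j)) =
    T (tilde b) j *+ (b == l).
  by rewrite tensmxE mxE mulr_natl.
have /matrixP/(_ (idx (k, tilde k)))/(_ (idx (k, j))) := RS.
rewrite -mulmxA [RHS]mxE !R'M.
have tilde_eqC (b l : 'I_n) : (tilde b == l) = (b == tilde l).
  by rewrite -(inj_eq (inv_inj (@tildeK n))) tildeK.
under eq_bigr do rewrite SRE mulrBr !mulrnAr !tilde_eqC.
under [in RHS]eq_bigr do rewrite TE mulrnAr.
rewrite sum_pick mulrN => /oppr_inj; rewrite sumrB !sum_pick theta_sqr mul1r.
rewrite /k tildeK theta_tilde2 // theta_tilde_self // pmMl mul1r => <-.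
congr (_ - _).
by rewrite zC !mulrA.
Qed.
End RankOne.

Section TwistedYangian.
Variables (K : fieldType) (G : classical_group) (n : nat).
Local Notation X := (Xalg K G n).
Local Notation S := (Smx K G n).
Hypothesis n_even : G = Symp -> ~~ odd n.

Lemma Smx_degle i j : degle 0 (S i j).
Proof. by move=> k k0; rewrite mxE /= leNgt k0. Qed.

Lemma Smx_lead i j : S i j 0 = (i == j)%:R.
Proof. by rewrite mxE. Qed.

Lemma Oseries_relation (O : nat -> X) : is_Oseries O -> forall i j,
  lvar *+ 2 * (theta _ G i * theta _ G j * S (tilde j) (tilde i))
    - pm G (S i j) =
  (lvar *+ 2 - pm G 1) * lseries O * lopp_var (S i j).
Proof.
move=> [_ O_def] i j.
set T := map_mx (@lopp_var X) S in O_def.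
have -> : lopp_var (S i j) = T i j by rewrite [RHS]mxE.
have [||Y [YT TY]] := @leading1_mx_inverse _ _ (mx2 T).
- move=> a b; case: (mxtens_indexP a) (mxtens_indexP b) => a1 a2 [b1 b2].
  move=> k k0; rewrite tensmxE !mxE mulr_natl.
  by case: (a1 == b1); rewrite ?coef0 //= leNgt k0 mulr0.
- move=> a b; case: (mxtens_indexP a) (mxtens_indexP b) => a1 a2 [b1 b2].
  rewrite tensmxE (inj_eq (can_inj (@mxtens_indexK n n))) !mxE mulr_natl.
  rewrite xpair_eqE.
  by case: (a1 == b1); rewrite ?coef0 //= expr0 mul1r.
have [cT _] : cinv (mx2 T) *m mx2 T = 1%:M /\ mx2 T *m cinv (mx2 T) = 1%:M.
  exact: cinvP YT TY.
apply: rank_one_relation => //.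
  by move=> x; rewrite mulrnAl mulrnAr comm_lvar.
by rewrite scalemxAl -O_def -(mulmxA _ (cinv (mx2 T))) cT mulmx1.
Qed.
End TwistedYangian.

(** * Differential operators *)

Section DifferentialOperators.
Variables (K : fieldType) (G : classical_group) (m n : nat).
Local Notation D := (pdo K m n).
Local Notation th := (@theta D G n).
Local Notation opp := (@lab_opp m).
Local Notation pop := (@pop K G n m).
Local Notation qop := (@qop K G n m).
Local Notation x := (@pdo_x K m n).
Local Notation d := (@pdo_d K m n).

Lemma pdo_xx a i b j : x a i * x b j = x b j * x a i.
Proof. by apply: pdo_eq => p /=; rewrite mulrCA. Qed.

Lemma pdo_dd a i b j : d a i * d b j = d b j * d a i.
Proof. by apply: pdo_eq => p /=; rewrite /xder mderiv_comm. Qed.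

Lemma pdo_dx a i b j :
  d a i * x b j = x b j * d a i + ((a == b) && (i == j))%:R.
Proof.
apply: pdo_eq => p /=; rewrite /xder /xvar mderivM mderivX mnm1E.
rewrite addrC (inj_eq (can_inj (@mxtens_indexK m n))) xpair_eqE.
rewrite [b == a]eq_sym [j == i]eq_sym; congr (_ + _).
have [/andP[/eqP -> /eqP ->]|_] := boolP ((a == b) && (i == j)); last first.
  by rewrite -scalerAl scale0r; exact: esym (scale0r _).
set v := mxtens_index _; have -> : (U_(v) - U_(v))%MM = 0%MM.
  by apply/mnmP => k; rewrite mnmBE mnm0E subnn.
by rewrite mpolyX0 scale1r mul1r; exact: esym (scale1r _).
Qed.

Lemma qop_pop c i e j :
  qop c i * pop e j = pop e j * qop c i + ((c == e) && (i == j))%:R.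
Proof.
have -> : (c == e) = (split c == split e) by rewrite (can_eq (@splitK m m)).
rewrite /qop /pop; case: (split c) => a; case: (split e) => b.
- by rewrite pdo_dx.
- rewrite /= addr0 mulrN mulNr mulrA -thetaC -!mulrA pdo_dd.
  by rewrite thetaC.
- rewrite /= addr0 mulrA -thetaC -!mulrA pdo_xx.
  done.
rewrite mulrN mulNr -!mulrA (mulrA (x a _)) -(thetaC G j (x a _)).
rewrite (mulrA (d b _)) -(thetaC G i (d b _)) -!mulrA pdo_dx !mulrDr opprD.
rewrite -addrA -[LHS]addr0; congr (- _ + _).
  by rewrite !mulrA (thetaC _ i).
have -> : ((b == a) && (tilde j == tilde i)) = ((inr a == inr b :> 'I_m + 'I_m)
    && (i == j)).
  by rewrite (inj_eq (inv_inj (@tildeK n))) [b == a]eq_sym [j == i]eq_sym.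
have [/andP[_ /eqP ->]|_] := boolP ((_ == _) && (i == j)).
  by rewrite mulrA theta_sqr mul1r addNr.
by rewrite !mulr0 oppr0 addr0.
Qed.

Hypothesis n_even : G = Symp -> ~~ odd n.

(** The operators [p_{c, tilde j}] and [q_{-c, j}] agree up to [theta_j] and
    this sign. *)
Definition pq_sign (c : 'I_(m + m)) : D := if G is Orth then - sgn D c else 1.

Lemma theta_pop_tilde c j : th j * pop c (tilde j) = pq_sign c * qop (opp c) j.
Proof.
rewrite /pop /qop /lab_opp /pq_sign /sgn; case: (split c) => a.
  rewrite (unsplitK (inr a)) opprK.
  by have -> : (if G is Orth then 1 else 1) = 1 :> D; [case: G | rewrite mul1r].
rewrite (unsplitK (inl a)) mulrN mulrA tildeK (thetaC G j).
rewrite theta_tilde_self // -mulNr; congr (_ * _).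
by case: G; rewrite //= opprK.
Qed.

Lemma pq_sign_sqr c : pq_sign c * pq_sign c = 1.
Proof. by rewrite /pq_sign; case: G; rewrite ?mulrNN ?sgn_sqr ?mulr1. Qed.

Lemma pq_sign_opp c : pq_sign (opp c) * pm G 1 = - pq_sign c.
Proof.
rewrite /pq_sign; case: G; rewrite /= ?mul1r //.
by rewrite sgn_opp mulr1.
Qed.

Lemma pq_signM c e : pq_sign c * pq_sign e = eps D G c e.
Proof. by rewrite /pq_sign /eps; case: G; rewrite ?mulrNN ?mulr1. Qed.

Lemma pq_signC c (y : D) : pq_sign c * y = y * pq_sign c.
Proof.
rewrite /pq_sign; case: G; last by rewrite mul1r mulr1.
by rewrite mulNr mulrN sgnC.
Qed.

Lemma theta_qop_tilde c i :
  th i * qop c (tilde i) = - pq_sign c * pop (opp c) i.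
Proof.
have e : th (tilde i) * pop (opp c) i = pq_sign (opp c) * qop c (tilde i).
  by have := theta_pop_tilde (opp c) (tilde i); rewrite tildeK lab_oppK.
have -> : qop c (tilde i) = pq_sign (opp c) * (th (tilde i) * pop (opp c) i).
  by rewrite e mulrA pq_sign_sqr mul1r.
rewrite (mulrA (th i)) (thetaC G i) -(mulrA (pq_sign (opp c))).
rewrite (mulrA (th i)) (thetaC G i).
by rewrite theta_tilde_self // mulrA pq_sign_opp.
Qed.

(** Reflecting all the indices turns [p] into [q] and [q] into [p]. The sign is
    that of the twisted transpose because [pq_sign c * pq_sign e = eps c e] for
    either group. *)
Lemma pop_qop_tilde c e i j :
  th i * th j * (pop c (tilde j) * qop e (tilde i)) =
  - (eps D G c e * (qop (opp c) j * pop (opp e) i)).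
Proof.
rewrite mulrA -(mulrA (th i)) theta_pop_tilde (thetaC G i) -(mulrA _ (th i)).
rewrite theta_qop_tilde mulNr mulrN (mulrA _ (pq_sign e)) -(mulrA (pq_sign c)).
by rewrite -(pq_signC e) (mulrA (pq_sign c)) pq_signM -mulrA.
Qed.
End DifferentialOperators.

(** * The image of the symmetry relation *)

Section DoubledVariableCentral.
Variables (A : pzRingType) (G : classical_group).
Local Notation z := (lvar *+ 2 - pm G 1 : laurent A).

Lemma doubled_var_central (f : laurent A) : lvar *+ 2 * f = f * (lvar *+ 2).
Proof. by rewrite mulrnAl mulrnAr comm_lvar. Qed.

Lemma doubled_var_pm_central f : z * f = f * z.
Proof.
by rewrite mulrBl mulrBr doubled_var_central pmMl pmMr mul1r mulr1.
Qed.
End DoubledVariableCentral.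

Section DoubledVariable.
Variables (K : fieldType) (A : kalgType K) (G : classical_group).
Hypothesis K2 : 2%:R != 0 :> K.
Local Notation D := (1 - pm G (lmono (-1) (kscal 2^-1))) (only parsing).

Lemma double_half : lmono 0 (kscal 2^-1) *+ 2 = 1 :> laurent A.
Proof.
have e : 2^-1 + 2^-1 = 1 :> K by rewrite -mulr2n -(mulr_natr 2^-1) mulVf.
apply: laurentP => k; rewrite mulr2n coefD coef1 /=.
by case: eqP => _; rewrite ?addr0 // -kscalD e kscal1.
Qed.

Lemma doubled_var_factor :
  lvar *+ 2 - pm G 1 = lvar *+ 2 * D :> laurent A.
Proof.
by rewrite mulrBr mulr1 pmMr mulrnAl lmono_mul mul1r addrN double_half.
Qed.

Lemma doubled_var_cinv :
  cinv D * D = 1 :> laurent A /\ D * cinv D = 1 :> laurent A.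
Proof.
have mono_neg k : 0 <= k -> pm G (lmono (-1) (kscal 2^-1 : A)) k = 0.
  move=> k0; have k1 : lmono (-1) (kscal 2^-1 : A) k = 0.
    by rewrite /=; case: eqP => // k1; rewrite k1 in k0.
  by rewrite /pm; case: G; rewrite ?coefN k1 ?oppr0.
have [||Y [YD DY]] := @leading1_inverse _ (D : laurent A).
- by move=> k k0; rewrite coefB coef1 mono_neg ?ltW // subr0 gt_eqF.
- by rewrite coefB coef1 mono_neg // subr0.
exact: cinvP YD DY.
Qed.

Lemma doubled_var_inverse : exists d, d * (lvar *+ 2 - pm G 1) = 1 :> laurent A.
Proof.
pose h : laurent A := lmono (-1) (kscal 2^-1).
have hu : h * (lvar *+ 2) = 1 by rewrite mulrnAr lmono_mul mulr1 double_half.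
have [cD _] := doubled_var_cinv; exists (cinv D * h).
rewrite doubled_var_factor; move: cD.
set d := 1 - _; set c := cinv d => cD.
by rewrite -mulrA (mulrA h) hu mul1r.
Qed.
End DoubledVariable.

Section AbstractSums.
Variables (L : pzRingType) (G : classical_group) (m : nat).

Lemma central_mul (y z : L) : (forall f, y * f = f * y) ->
  (forall f, z * f = f * z) -> forall f, y * z * f = f * (y * z).
Proof. by move=> yC zC f; rewrite -mulrA zC mulrA yC mulrA. Qed.

(** Reindexes by [(c, d) |-> (- d, - c)], as the twisted transpose does. *)
Lemma sum_lab_flip (f : 'I_(m + m) -> 'I_(m + m) -> L) (g : 'I_(m + m) -> L) :
  \sum_c \sum_d (- f (lab_opp d) (lab_opp c) - g c *+ (d == c)) =
  - \sum_c \sum_d f c d - \sum_c g c.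
Proof.
under eq_bigr => c _ do rewrite sumrB sumrN sum_pick.
rewrite sumrB sumrN exchange_big /=; congr (- _ - _).
rewrite [RHS](reindex_inj (inv_inj (@lab_oppK m))); apply: eq_bigr => c _.
by rewrite [RHS](reindex_inj (inv_inj (@lab_oppK m))).
Qed.

Lemma pm_sum (I : finType) (f : I -> L) :
  pm G (\sum_c f c) = \sum_c pm G (f c).
Proof. by rewrite /pm; case: G; rewrite // -sumrN. Qed.

(** The linear algebra of [beta_relation]: [v] stands for [2u], [tr] for the
    trace of the resolvent, and [p], [q], [r] for the terms with the twisted
    transpose of the resolvent at [u], with the resolvent at [u] and with the
    resolvent at [-u]. The hypothesis on [Z] makes the diagonal terms carry the
    same factor as the sums. *)
Lemma reflected_sum_relation (I : finType) (v tr Z : L) (p q r : I -> I -> L)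
    (e : bool) :
  (forall c d, v * p c d + pm G (q c d) = - (Z * r c d)) ->
  Z = v - pm G 1 - v * tr ->
  v * ((1 - tr) *+ e - \sum_c \sum_d p c d)
    - pm G (e%:R + \sum_c \sum_d q c d) =
  Z * (e%:R + \sum_c \sum_d r c d).
Proof.
move=> pqr ZE; set S1 := \sum_c _; set S2 := \sum_c _; set S3 := \sum_c _.
have S12 : v * S1 + pm G S2 = - (Z * S3).
  rewrite /S1 /S2 /S3 pm_sum !mulr_sumr -big_split -sumrN /=.
  apply: eq_bigr => c _; rewrite pm_sum !mulr_sumr -big_split -sumrN /=.
  by apply: eq_bigr => d _; exact: pqr.
have -> : pm G (e%:R + S2) = pm G 1 *+ e + pm G S2.
  by rewrite /pm; case: G; rewrite // opprD mulNrn.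
have -> : v * ((1 - tr) *+ e - S1) = (v - v * tr) *+ e - v * S1.
  by rewrite mulrBr mulrnAr mulrBr mulr1.
have shuffle (a b c d : L) : a - b - (c + d) = (a - c) - (b + d).
  by rewrite !opprD [LHS]addrACA.
rewrite shuffle S12 opprK mulrDr mulr_natr -mulrnBl ZE.
by rewrite [v - v * tr - _]addrAC.
Qed.
End AbstractSums.

Section TensorSigns.
Variables (K : fieldType) (A B : kalgType K) (G : classical_group) (n m : nat).

Lemma ltens_eps (a b : 'I_(m + m)) (f : laurent A) (y : B) :
  ltens (eps _ G a b * f) y = ltens f (eps _ G a b * y).
Proof.
rewrite /eps /sgn; case: G; last by rewrite !mul1r.
by case: (split a) => _; case: (split b) => _;
  rewrite ?mulN1r ?mulrN1 ?mulr1 ?opprK ?mulN1r ?mul1r ?ltensNl ?ltensNr.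
Qed.

Lemma theta_ltens (i : 'I_n) (f : laurent A) (y : B) :
  theta _ G i * ltens f y = ltens f (theta _ G i * y).
Proof.
rewrite /theta; case: G; first by rewrite !mul1r.
rewrite -signr_odd -[in RHS]signr_odd.
by case: (odd i); rewrite ?mulN1r ?mul1r ?ltensNr.
Qed.

Lemma ltens_pm (f : laurent A) (y : B) : ltens (pm G f) y = pm G (ltens f y).
Proof. by rewrite /pm; case: G; rewrite ?ltensNl. Qed.

Lemma ltens_doubled_var : ltens (lvar *+ 2 : laurent A) (1 : B) = lvar *+ 2.
Proof. by rewrite !mulr2n ltensDl ltens_lvar. Qed.

Lemma ltens_doubled_var_pm :
  ltens (lvar *+ 2 - pm G 1 : laurent A) (1 : B) = lvar *+ 2 - pm G 1.
Proof.
by rewrite ltensDl ltens_doubled_var ltensNl ltens_pm ltens1.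
Qed.
End TensorSigns.

Section BetaRelation.
Variables (K : fieldType) (G : classical_group) (n m : nat).
Hypothesis K_char0 : [pchar K] =i pred0.
Hypothesis n_even : G = Symp -> ~~ odd n.
Local Notation lab := 'I_(m + m).
Local Notation opp := (@lab_opp m).
Local Notation U := (Uf K G m).
Local Notation D := (pdo K m n).
Local Notation B := (Balg K G n m).
Local Notation pop := (@pop K G n m).
Local Notation qop := (@qop K G n m).
Local Notation T := (beta_series K G m).

Definition Fhat : 'M[laurent U]_(m + m) :=
  shifted_resolvent (fshift K G m) (Fmx K G m).

Lemma two_neq0 : 2%:R != 0 :> K. Proof. by rewrite (pcharf0P _).1. Qed.

Lemma fshift_half : fshift K G m *+ 2 = (m + m)%:R + pm G 1.
Proof.
rewrite /fshift mulrnDl addrC natrD -mulr2n; congr (_ + _).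
have e : 2^-1 *+ 2 = 1 :> K by rewrite -(mulr_natr 2^-1) mulVf ?two_neq0.
by rewrite /pm; case: G; rewrite ?mulNrn e.
Qed.

Lemma Wbar_trace : (lvar *+ 2 - pm G 1) * Wbar K G m = lvar *+ 2 * \tr Fhat.
Proof.
have Wt : ltranslate (fshift K G m) (Wser K G m) = \tr Fhat.
  rewrite /Wser raddf_sum; apply: eq_bigr => c _; exact: esym (mxE _ _ _ _).
have [_ Dc] := doubled_var_cinv U G.
rewrite /Wbar Wt (doubled_var_factor U G two_neq0); move: Dc.
set d := 1 - _; set c := cinv d => Dc.
by rewrite -mulrA (mulrA d) Dc mul1r.
Qed.

Lemma Fhat_relation a b :
  lvar *+ 2 * twist G Fhat a b + pm G (Fhat a b) =
  - (lopp_var (Fhat a b) * ((lvar *+ 2 - pm G 1) * (1 - Wbar K G m))).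
Proof.
have -> := shifted_resolvent_sym K_char0 (@Fmx_twist K G m) (@Fmx_bracket K G m)
  fshift_half a b.
rewrite -mulrN; congr (_ * _).
rewrite [in RHS]mulrBr mulr1 Wbar_trace opprB mulrBr mulr1.
by rewrite opprB addrA addrAC -addrA.
Qed.

Lemma beta_seriesE i j : T i j =
  (i == j)%:R + \sum_c \sum_d ltens (Fhat c d) (pop c i * qop d j).
Proof.
congr (_ + _); apply: eq_bigr => c _; apply: eq_bigr => d _.
by rewrite [Fhat c d]mxE.
Qed.

(** After the reflection of the indices the factors of each [p q] appear in the
    order [q p]; the commutators that restore the order of [beta_series] add up
    to the trace. *)
Lemma beta_series_tilde i j :
  theta _ G i * theta _ G j * T (tilde j) (tilde i) =
  (1 - ltens (\tr Fhat) 1) *+ (i == j) -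
  \sum_c \sum_d ltens (twist G Fhat c d) (pop c i * qop d j).
Proof.
rewrite beta_seriesE (inj_eq (inv_inj (@tildeK n))) mulrDr [j == i]eq_sym.
have -> : theta _ G i * theta _ G j * (i == j)%:R = (i == j)%:R :> laurent B.
  by case: eqP => [->|_]; rewrite ?mulr0 // theta_sqr mulr1.
rewrite mulrnBl -addrA; congr (_ + _).
rewrite mulr_sumr.
have term c d : theta _ G i * theta _ G j *
    ltens (Fhat c d) (pop c (tilde j) * qop d (tilde i)) =
    - ltens (twist G Fhat (opp d) (opp c)) (pop (opp d) i * qop (opp c) j)
    - ltens (Fhat c c) 1 *+ (i == j) *+ (d == c).
  rewrite -mulrA !theta_ltens mulrA pop_qop_tilde // ltensNr -ltens_eps.
  have e1 : eps _ G c d * Fhat c d = twist G Fhat (opp d) (opp c).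
    by rewrite [twist _ _ _ _]mxE !lab_oppK eps_opp eps_sym.
  have e2 : ltens (eps _ G c d * Fhat c d)
      ((opp c == opp d) && (j == i))%:R =
      ltens (Fhat c c) (1 : D) *+ (i == j) *+ (d == c).
    rewrite (inj_eq (inv_inj (@lab_oppK m))) [c == d]eq_sym [j == i]eq_sym.
    have [->|_] := eqVneq d c; last exact: ltens0r.
    rewrite eps_refl mul1r mulr1n.
    by case: (i == j) => //; exact: ltens0r.
  rewrite qop_pop (ltensDr _ (pop (opp d) i * qop (opp c) j)) opprD e2 e1.
  by [].
have -> : ltens (\tr Fhat) (1 : D) *+ (i == j) =
    \sum_c ltens (Fhat c c) (1 : D) *+ (i == j).
  rewrite sumrMnl; congr (_ *+ _).
  exact: raddf_sum (lmap (tensr (1 : D))) _ _ _ _.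
rewrite addrC.
apply: etrans _ (sum_lab_flip
  (fun c d => ltens (twist G Fhat c d) (pop c i * qop d j)) _).
apply: eq_bigr => c _; rewrite mulr_sumr; apply: eq_bigr => d _; exact: term.
Qed.

Hypothesis Wbar_central :
  forall f, (1 - Wbar K G m) * f = f * (1 - Wbar K G m).

Lemma beta_relation i j :
  lvar *+ 2 * (theta _ G i * theta _ G j * T (tilde j) (tilde i))
    - pm G (T i j) =
  (lvar *+ 2 - pm G 1) * (ltens (1 - Wbar K G m) (1 : D) * lopp_var (T i j)).
Proof.
pose z : laurent U := lvar *+ 2 - pm G 1.
have zE : ltens z (1 : D) = lvar *+ 2 - pm G 1 by exact: ltens_doubled_var_pm.
have zC f : z * f = f * z by exact: doubled_var_pm_central.
pose y := z * (1 - Wbar K G m).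
have yC f : y * f = f * y.
  exact: central_mul.
have ZE : (lvar *+ 2 - pm G 1) * ltens (1 - Wbar K G m) (1 : D) =
    ltens y (1 : D).
  by rewrite -zE -ltens_mul mulr1.
rewrite beta_series_tilde beta_seriesE mulrA ZE.
have -> : lopp_var ((i == j)%:R + \sum_c \sum_d
      ltens (Fhat c d) (pop c i * qop d j)) =
    (i == j)%:R + \sum_c \sum_d
      ltens (lopp_var (Fhat c d)) (pop c i * qop d j).
  rewrite raddfD /= rmorph_nat raddf_sum; congr (_ + _).
  apply: eq_bigr => c _; rewrite raddf_sum; apply: eq_bigr => d _.
  exact: esym (ltens_lopp_var _ _).
apply: reflected_sum_relation => [c d|].
  rewrite -ltens_doubled_var -!ltens_mul !mul1r -ltens_pm -ltensDl -ltensNl.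
  by rewrite Fhat_relation -/z -/y yC.
have -> : y = z - lvar *+ 2 * \tr Fhat by rewrite -Wbar_trace /y mulrBr mulr1.
rewrite ltensDl zE ltensNl; congr (_ - _).
by rewrite -ltens_doubled_var -ltens_mul mulr1.
Qed.
End BetaRelation.

(** * Renormalization *)

Section CentralFactor.
Variables (A : pzRingType) (W : laurent A).
Hypothesis W_deg : degle 0 W.
Hypothesis W_lead : W 0 = 1.
Hypothesis W_central : forall k x, W k * x = x * W k.

Lemma leading1_cinv : cinv W * W = 1 /\ W * cinv W = 1.
Proof.
by have [V [VW WV]] := leading1_inverse W_deg W_lead; exact: cinvP VW WV.
Qed.

Lemma central_laurent f : W * f = f * W.
Proof. by apply: comm_laurent => i j; exact: W_central. Qed.

Lemma central_cinv f : cinv W * f = f * cinv W.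
Proof.
have [VW WV] := leading1_cinv.
by rewrite -[LHS]mulr1 -WV mulrA -(mulrA _ f) -central_laurent mulrA VW mul1r.
Qed.

Lemma central_lopp_var f : lopp_var W * f = f * lopp_var W.
Proof. by rewrite -[f]lopp_varK -!rmorphM central_laurent. Qed.
End CentralFactor.

Lemma coef_lseries (A : pzRingType) (a : nat -> A) r :
  lseries a (- r%:Z) = a r.
Proof. by rewrite /= oppr_le0 abszN. Qed.

Lemma cancel_units (A : pzRingType) (d z s r o : A) :
  d * z = 1 -> s * r = 1 -> z * s = z * o * s -> o = 1.
Proof.
move=> dz sr /(congr1 (fun f => d * (f * r))).
by rewrite -!(mulrA _ s) sr !mulr1 mulrA dz mul1r => <-.
Qed.

Section Renormalization.
Variables (A : pzRingType) (G : classical_group).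
Local Notation z := (lvar *+ 2 - pm G 1 : laurent A).

(** By [Ww], the factor [w] is exactly what turns [W] times [lopp_var y] into
    [lopp_var (W * y)]. *)
Lemma renormalized_relation (W w t x y o : laurent A) :
  W * w = lopp_var W -> (forall f, t * f = f * t) ->
  lvar *+ 2 * (t * x) - pm G y = z * (w * lopp_var y) ->
  lvar *+ 2 * (t * (W * x)) - pm G (W * y) = z * o * lopp_var (W * y) ->
  z * lopp_var (W * y) = z * o * lopp_var (W * y).
Proof.
move=> Ww tC xy <-; rewrite (mulrA t) tC -(mulrA W) (mulrA _ W).
rewrite doubled_var_central -mulrA -pmMr -mulrBr xy.
have -> : lopp_var (W * y) = lopp_var W * lopp_var y by exact: rmorphM.
by rewrite -Ww [RHS]mulrA -(doubled_var_pm_central G W) !mulrA.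
Qed.

Lemma lmap_relation (B : pzRingType) (phi : {rmorphism A -> B}) n
    (i j : 'I_n) (x y : laurent A) (o : nat -> A) :
  lvar *+ 2 * (theta _ G i * theta _ G j * x) - pm G y =
    z * lseries o * lopp_var y ->
  lvar *+ 2 * (theta _ G i * theta _ G j * lmap phi x) - pm G (lmap phi y) =
    (lvar *+ 2 - pm G 1) * lseries (phi \o o) * lopp_var (lmap phi y).
Proof.
have lhs (psi : {rmorphism laurent A -> laurent B}) :
    psi (lvar *+ 2 * (theta _ G i * theta _ G j * x) - pm G y) =
    psi lvar *+ 2 * (theta _ G i * theta _ G j * psi x) - pm G (psi y).
  have th k : psi (theta _ G k) = theta _ G k.
    by rewrite /theta; case: G; rewrite ?rmorphXn ?rmorphN1 ?rmorph1.
  by rewrite rmorphB !rmorphM rmorphMn !th (rmorph_pm psi).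
have rhs (psi : {rmorphism laurent A -> laurent B}) :
    psi (z * lseries o * lopp_var y) =
    (psi lvar *+ 2 - pm G 1) * psi (lseries o) * psi (lopp_var y).
  by rewrite !rmorphM rmorphB rmorphMn (rmorph_pm psi) rmorph1.
move/(congr1 (lmap phi)); rewrite (lhs (lmap phi)) (rhs (lmap phi)).
by rewrite /= lmap_lvar lmap_lseries lmap_lopp_var.
Qed.
End Renormalization.

Theorem proposition2p5 (R : realType) (G : classical_group) (n m : nat)
  (n_gt0 : (0 < n)%N) (m_gt0 : (0 < m)%N) (n_even : G = Symp -> ~~ odd n)
  (O : nat -> Xalg R[i] G n) (O_def : is_Oseries O)
  (beta : {rmorphism Xalg R[i] G n -> Balg R[i] G n m})
  (beta_alg : kalg_hom beta)
  (beta_def : forall i j, lmap beta (Smx R[i] G n i j) = beta_series R[i] G m i j)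
  (W : laurent (Uf R[i] G m)) (W_def : is_Wtilde W)
  (betat : {rmorphism Xalg R[i] G n -> Balg R[i] G n m})
  (betat_alg : kalg_hom betat)
  (betat_def : forall i j,
     lmap betat (Smx R[i] G n i j)
       = ltens W (1 : pdo R[i] m n) * lmap beta (Smx R[i] G n i j)) :
  forall r, (0 < r)%N -> betat (O r) = 0.
Proof.
have K_char0 : [pchar R[i]] =i pred0 by exact: pchar_num.
have [W_deg W_lead W_central W_eq] := W_def.
pose w := 1 - Wbar R[i] G m; rewrite -/w in W_eq.
have wC f : w * f = f * w.
  rewrite -W_eq; apply: central_mul; first exact: central_lopp_var.
  exact: central_cinv.
have Ww : W * w = lopp_var W.
  have [VW _] := leading1_cinv W_deg W_lead.
  by rewrite -wC -W_eq -mulrA VW mulr1.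
pose W1 := ltens W (1 : pdo R[i] m n).
have W1w : W1 * ltens w 1 = lopp_var W1.
  by rewrite -ltens_mul mulr1 Ww ltens_lopp_var.
pose St i j := lmap betat (Smx R[i] G n i j).
pose o := lseries (betat \o O).
(* Any diagonal entry will do: it has leading coefficient [1], hence can be
   cancelled. *)
pose i := Ordinal n_gt0.
pose z : laurent (Balg R[i] G n m) := lvar *+ 2 - pm G 1.
have StE j k : St j k = W1 * beta_series R[i] G m j k.
  by rewrite /St betat_def beta_def.
have o_rel : z * lopp_var (St i i) = z * o * lopp_var (St i i).
  have b_rel := beta_relation K_char0 n_even wC i i.
  have s_rel := lmap_relation betat (Oseries_relation n_even O_def i i).
  rewrite -/(St _ _) -/(St i i) !StE in s_rel *.
  apply: renormalized_relation W1w _ b_rel s_rel.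
  by apply: central_mul => f; exact: thetaC.
have Sii_lead : Smx R[i] G n i i 0 = 1 by rewrite Smx_lead eqxx.
have [V [_ SV]] := leading1_inverse (@Smx_degle _ _ _ i i) Sii_lead.
have StV : lopp_var (St i i) * lmap betat (lopp_var V) = 1.
  rewrite /St -lmap_lopp_var.
  apply: etrans (esym (rmorphM (lmap betat) _ _)) _.
  apply: etrans (congr1 (lmap betat) (esym (rmorphM (@lopp_var _) _ _))) _.
  by rewrite SV !rmorph1.
have [d dz] := doubled_var_inverse (Balg R[i] G n m) G (two_neq0 K_char0).
have o1 : o = 1 by exact: cancel_units dz StV o_rel.
move=> r r0; rewrite -[betat (O r)]/((betat \o O) r) -coef_lseries -/o o1 coef1.
by rewrite oppr_eq0 gt_eqF.
Qed.
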